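(* Let $p$ be a prime, $\kappa$ a perfect field of characteristic $p$, $K_0=\kappa((t))$, and let $K_2/K_0$ be a fully ramified Galois extension of degree $p^2$ with group $G$, described by the data $\beta_1,\beta_2,\mu,\varepsilon,\sigma_1,\sigma_2$ of the context. Assume $v_0(\varepsilon)>v_0(\beta_2)+(p-1)b_1/p$, and if $G\cong C_{p^2}$ assume in addition $v_0(\beta_1^p)>v_0(\beta_2)+(p-1)b_1/p$. Then $K_2/K_0$ has a Galois scaffold. More precisely, define $\Psi_1=\sigma_1\sigma_2^{[\mu]}-1\in K_0[G]$, where $\sigma_2^{[\mu]}=\sum_{i=0}^{p-1}\binom{\mu}{i}(\sigma_2-1)^i$, and $\Psi_2=\sigma_2-1$. Then for every $\alpha\in K_2$ with $v_2(\alpha)\equiv b_2\pmod{p^2}$ and all $0\le i,j\le p-1$, $$v_2(\Psi_2^i\Psi_1^j\alpha)=v_2(\alpha)+ib_2+jpb_1.$$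
   Context: Notation: $v_0$ is the normalized valuation of $K_0$, $v_2$ the normalized valuation of $K_2$ ($v_2(K_2^\times)=\mathbb Z$), $\wp(X)=X^p-X$, $\wp(K_0)=\{\wp(k):k\in K_0\}$, $\delta_{i,j}$ the Kronecker delta, $\binom{X}{i}=X(X-1)\cdots(X-i+1)/i!$. $b_1\le b_2$ are the lower ramification numbers of $K_2/K_0$ counted with multiplicity ($b_1$ is the ramification number of $K_1/K_0$ and $b_2$ that of $K_2/K_1$, with $K_1$ as below). Description of the extension. (Case $G\cong C_p\times C_p$.) $K_2=K_0(x_1,x_2)$ with $\wp(x_i)=\beta_i\in K_0$; the classes of $\beta_1,\beta_2$ span a $2$-dimensional $\mathbb F_p$-subspace of $K_0/\wp(K_0)$; $\beta_1$ has maximal valuation among elements of $\mathbb F_p\beta_1+\mathbb F_p\beta_2+\wp(K_0)$ not in $\wp(K_0)$, and $\beta_2$ has maximal valuation in its coset $\beta_2+\mathbb F_p\beta_1+\wp(K_0)$; $K_1=K_0(x_1)$; $\sigma_1,\sigma_2\in G$ with $(\sigma_i-1)x_j=\delta_{i,j}$. Here $v_0(\beta_1)=-b_1$, $p\nmid b_1$. (Case $G\cong C_{p^2}$.) $K_1=K_0(x_1)$, $\wp(x_1)=\beta_1\in K_0$ of maximal valuation in $\beta_1+\wp(K_0)$, $v_0(\beta_1)=-b_1<0$, $p\nmid b_1$; $D_1=-\sum_{i=1}^{p-1}\frac1p\binom{p}{i}x_1^i\beta_1^{p-i}$; $K_2=K_0(x_2)$ with $\wp(x_2)=D_1+\beta_2$,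 $\beta_2\in K_0$ of maximal valuation in $\beta_2+\mathbb F_p\beta_1+\wp(K_0)$; $\sigma_1$ generates $G$, $(\sigma_1-1)x_1=1$, $\sigma_2=\sigma_1^p$, $(\sigma_2-1)x_2=1$. In both cases write $\beta_2=\sum_{t=0}^{p-1}\mu_t^p\beta_1^t$ with $\mu_t\in K_0$, $\mu_0^p\in\kappa$; set $\mu=\mu_1$, $\varepsilon=\beta_2-\mu^p\beta_1$. Galois scaffold: with $I$ the augmentation ideal of $K_0[G]$ (generated by $\sigma-1$, $\sigma\in G$), a Galois scaffold is a pair $\Psi_1,\Psi_2\in I$ such that (i) for $i=1,2$, all $0\le j<p$ and all $\rho,\rho'\in K_2$ with $v_2(\rho)\equiv v_2(\rho')\equiv b_2\pmod{p^2}$, $v_2(\Psi_i^j\rho)-v_2(\rho)=j\,(v_2(\Psi_i\rho')-v_2(\rho'))$; and (ii) for every $\rho\in K_2$ with $v_2(\rho)\equiv b_2\pmod{p^2}$, the set $\{v_2(\Psi_2^{a_0}\Psi_1^{a_1}\rho):0\le a_0,a_1<p\}$ is a complete set of residues modulo $p^2$. *)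

(* Defs.v *)
From HB Require Import structures.
From mathcomp Require Import all_boot all_order all_algebra all_fingroup.
From mathcomp Require Import all_solvable all_field.
From mathcomp Require Import mathcomp_extra boolp classical_sets functions.
From mathcomp Require Import cardinality fsbigop constructive_ereal.
From mathcomp Require Import ring.

Set Implicit Arguments.
Unset Strict Implicit.
Unset Printing Implicit Defensive.

Import Order.TTheory GRing.Theory Num.Theory.
Local Open Scope ring_scope.

Section Laurent.
Variable K : fieldType.
Implicit Types (f g h : int -> K) (N : int).

Definition vanishes_below f N := forall n, n < N -> f n = 0.

Record laurent : Type := Laurent {
  lcoef : int -> K;
  lcoefP : exists N, vanishes_below lcoef N }.

HB.instance Definition _ := gen_eqMixin laurent.
HB.instance Definition _ := gen_choiceMixin laurent.

Implicit Types x y z : laurent.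

Lemma laurentP x y : lcoef x =1 lcoef y -> x = y.
Proof.
case: x y => [f hf] [g hg] /= /funext e; subst g.
by rewrite (Prop_irrelevance hf hg).
Qed.

Lemma vanishes_belowW f N N' : N' <= N -> vanishes_below f N ->
  vanishes_below f N'.
Proof. by move=> le_N f0 n n_lt; apply: f0; apply: lt_le_trans le_N. Qed.

(* The sum has finite support when f and g are bounded below. *)
Definition conv f g (n : int) : K :=
  \sum_(i \in [set: int]) (f i * g (n - i)).

Lemma convE f g N N' (n : nat) :
    vanishes_below f N -> vanishes_below g N' ->
  conv f g (N + N' + n%:Z) =
  \sum_(j < n.+1) f (N + j%:Z) * g (N' + (n - j)%N%:Z).
Proof.
move=> f0 g0; rewrite /conv.
rewrite -(@fsbig_widen _ _ 0 +%R [set i | (N <= i) && (i <= N + n%:Z)] setT);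
  last 2 first.
- by [].
- move=> i [_ /= /negP]; rewrite negb_and -!ltNge => /orP[iN|iN].
    by rewrite f0 ?mul0r.
  rewrite g0 ?mulr0// ltrBlDr (_ : N + N' + n%:Z = N' + (N + n%:Z)); last first.
    by rewrite [N + N']addrC addrA.
  by rewrite ltrD2l.
rewrite (@reindex_fsbig _ 0 +%R nat int (fun j : nat => N + j%:Z) `I_n.+1).
  rewrite -fsbig_ord; apply: eq_bigr => -[j /= jn] _.
  by congr (_ * g _); rewrite -subzn//; ring.
split.
- by move=> j /= jn; rewrite lerDl lerD2l.
- by move=> i j _ _ /addrI[].
- move=> i /= /andP[Ni iN]; exists `|i - N|%N.
    by rewrite /= ltnS -lez_nat gez0_abs ?subr_ge0// lerBlDl.
  by rewrite /= gez0_abs ?subr_ge0//; ring.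
Qed.

Lemma conv_vanishes f g N N' :
  vanishes_below f N -> vanishes_below g N' ->
  vanishes_below (conv f g) (N + N').
Proof.
move=> f0 g0 n n_lt; rewrite /conv fsbig1// => i _.
have [iN|Ni] := ltP i N; first by rewrite f0 ?mul0r.
by rewrite g0 ?mulr0// ltrBlDr (lt_le_trans n_lt)// addrC lerD2l.
Qed.

Definition lshape f N (M : nat) : {poly K} := \poly_(i < M) f (N + i%:Z).

Lemma conv_lshape f g N N' M (n : nat) : (n < M)%N ->
    vanishes_below f N -> vanishes_below g N' ->
  conv f g (N + N' + n%:Z) = (lshape f N M * lshape g N' M)`_n.
Proof.
move=> nM f0 g0; rewrite convE// coefM; apply: eq_bigr => -[j /= jn] _.
by rewrite !coef_poly !(leq_ltn_trans _ nM)// ?leq_subr.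
Qed.

Lemma lge_nat (N n : int) : N <= n -> exists k : nat, n = N + k%:Z.
Proof.
move=> Nn; exists `|n - N|%N.
by rewrite gez0_abs ?subr_ge0//; ring.
Qed.

Lemma lshape_conv f g N N' M (n : nat) : (n < M)%N ->
    vanishes_below f N -> vanishes_below g N' ->
  (lshape (conv f g) (N + N') M)`_n = (lshape f N M * lshape g N' M)`_n.
Proof. by move=> nM f0 g0; rewrite coef_poly nM; apply: conv_lshape. Qed.

Lemma convA_fun f g h : (exists N, vanishes_below f N) ->
    (exists N, vanishes_below g N) -> (exists N, vanishes_below h N) ->
  conv f (conv g h) =1 conv (conv f g) h.
Proof.
move=> [N f0] [N' g0] [N'' h0] n.
have fg0 := conv_vanishes f0 g0; have gh0 := conv_vanishes g0 h0.
have [nlt|nge] := ltP n (N + N' + N'').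
  by rewrite (conv_vanishes fg0 h0)// (conv_vanishes f0 gh0)// addrA.
have [k ->] := lge_nat nge; rewrite (conv_lshape (ltnSn k) fg0 h0).
rewrite -[N + N' + N'']addrA (conv_lshape (ltnSn k) f0 gh0).
have -> : (lshape f N k.+1 * lshape (conv g h) (N' + N'') k.+1)`_k =
    (lshape f N k.+1 * (lshape g N' k.+1 * lshape h N'' k.+1))`_k.
  rewrite coefM [RHS]coefM; apply: eq_bigr => j _; congr (_ * _).
  by rewrite lshape_conv ?ltnS ?leq_subr.
rewrite mulrA coefM [RHS]coefM; apply: eq_bigr => j _; congr (_ * _).
by rewrite lshape_conv.
Qed.

Lemma convC_fun f g : (exists N, vanishes_below f N) ->
  (exists N, vanishes_below g N) -> conv f g =1 conv g f.
Proof.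
move=> [N f0] [N' g0] n.
have [nlt|nge] := ltP n (N + N').
  by rewrite (conv_vanishes f0 g0)// (conv_vanishes g0 f0)// addrC.
have [k ->] := lge_nat nge; rewrite (conv_lshape (ltnSn k) f0 g0).
by rewrite [N + N']addrC (conv_lshape (ltnSn k) g0 f0) mulrC.
Qed.

Definition ldelta (m : int) (c : K) (n : int) : K := if n == m then c else 0.

Lemma ldelta_vanishes m c : vanishes_below (ldelta m c) m.
Proof. by move=> n nm; rewrite /ldelta lt_eqF. Qed.

Lemma conv_ldelta m c g n : conv (ldelta m c) g n = c * g (n - m).
Proof.
rewrite /conv -(@fsbig_widen _ _ 0 +%R [set m] setT)//.
  by rewrite fsbig_set1 /ldelta eqxx.
by move=> i [_ /= /eqP/negPf im]; rewrite /ldelta im mul0r.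
Qed.

Lemma lzero_subproof : exists N, vanishes_below (fun _ => 0) N.
Proof. by exists 0. Qed.

Lemma ladd_subproof x y :
  exists N, vanishes_below (fun n => lcoef x n + lcoef y n) N.
Proof.
case: x y => f [N f0] [g [N' g0]] /=; exists (Num.min N N') => n.
by rewrite lt_min => /andP[nN nN']; rewrite f0// g0// addr0.
Qed.

Lemma lopp_subproof x : exists N, vanishes_below (fun n => - lcoef x n) N.
Proof. by case: x => f [N f0]; exists N => n nN /=; rewrite f0// oppr0. Qed.

Lemma lmul_subproof x y :
  exists N, vanishes_below (conv (lcoef x) (lcoef y)) N.
Proof.
case: x y => f [N f0] [g [N' g0]] /=; exists (N + N').
exact: conv_vanishes.
Qed.

Lemma lmono_subproof m c : exists N, vanishes_below (ldelta m c) N.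
Proof. by exists m; apply: ldelta_vanishes. Qed.

Definition lzero := Laurent lzero_subproof.
Definition ladd x y := Laurent (ladd_subproof x y).
Definition lopp x := Laurent (lopp_subproof x).
Definition lmul x y := Laurent (lmul_subproof x y).
(* The monomial c t^m. *)
Definition lmono (m : int) (c : K) := Laurent (lmono_subproof m c).
Definition lconst (c : K) := lmono 0 c.

Lemma laddA : associative ladd.
Proof. by move=> x y z; apply: laurentP => n /=; rewrite addrA. Qed.

Lemma laddC : commutative ladd.
Proof. by move=> x y; apply: laurentP => n /=; rewrite addrC. Qed.

Lemma ladd0 : left_id lzero ladd.
Proof. by move=> x; apply: laurentP => n /=; rewrite add0r. Qed.

Lemma laddN : left_inverse lzero lopp ladd.
Proof. by move=> x; apply: laurentP => n /=; rewrite addNr. Qed.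

HB.instance Definition _ := GRing.isZmodule.Build laurent laddA laddC ladd0 laddN.

Lemma lmulA : associative lmul.
Proof.
by move=> x y z; apply: laurentP => n; apply: convA_fun; apply: lcoefP.
Qed.

Lemma lmulC : commutative lmul.
Proof. by move=> x y; apply: laurentP => n; apply: convC_fun; apply: lcoefP. Qed.

Lemma lmul1 : left_id (lconst 1) lmul.
Proof.
by move=> x; apply: laurentP => n /=; rewrite conv_ldelta subr0 mul1r.
Qed.

Lemma lmulD : left_distributive lmul ladd.
Proof.
move=> x y z; apply: laurentP => n.
have [N xy0] : exists N, vanishes_below (lcoef x) N /\ vanishes_below (lcoef y) N.
  have [N x0] := lcoefP x; have [N' y0] := lcoefP y.
  exists (Num.min N N'); split.
    by apply: vanishes_belowW x0; rewrite ge_min lexx.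
  by apply: vanishes_belowW y0; rewrite ge_min lexx orbT.
have [x0 y0] := xy0; have [N' z0] := lcoefP z.
have s0 : vanishes_below (lcoef (ladd x y)) N.
  by move=> m mN /=; rewrite x0// y0// addr0.
rewrite /lmul /ladd /=.
have [nlt|nge] := ltP n (N + N').
  by rewrite !(@conv_vanishes _ _ N N')// addr0.
have [k ->] := lge_nat nge; rewrite !convE//= -big_split /=.
by apply: eq_bigr => j _; rewrite mulrDl.
Qed.

Lemma lone_neq0 : lconst 1 != 0 :> laurent.
Proof.
apply/eqP => /(congr1 (fun x => lcoef x 0)) /=; rewrite /ldelta eqxx => /eqP.
by rewrite oner_eq0.
Qed.

HB.instance Definition _ := GRing.Zmodule_isComNzRing.Build laurent
  lmulA lmulC lmul1 lmulD lone_neq0.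

Definition lorder_spec x (n : int) :=
  lcoef x n != 0 /\ vanishes_below (lcoef x) n.

Lemma lorder_exists x : x != 0 -> exists n, lorder_spec x n.
Proof.
move=> x0; have [N xN] := lcoefP x.
have ex : exists k : nat, lcoef x (N + k%:Z) != 0.
  apply: contrapT => nex; case/eqP: x0; apply: laurentP => n /=.
  have [/xN//|/lge_nat[k ->]] := ltP n N.
  by apply/eqP; apply: contrapT => /negP xk; apply: nex; exists k.
exists (N + (ex_minn ex)%:Z); case: ex_minnP => k xk kmin; split=> // n nk.
have [/xN//|/lge_nat[j nE]] := ltP n N; subst n.
apply/eqP; apply: contrapT => /negP /kmin kj.
by move: nk; rewrite ltrD2l ltz_nat ltnNge kj.
Qed.

Lemma lorder_uniq x m n : lorder_spec x m -> lorder_spec x n -> m = n.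
Proof.
move=> [xm m0] [xn n0]; have [mn|nm|//] := ltgtP m n.
  by rewrite n0 ?eqxx in xm.
by rewrite m0 ?eqxx in xn.
Qed.

(* Coefficients, up to index n, of the inverse of a power series a with
   a 0 != 0. *)
Fixpoint linv_seq (a : nat -> K) (n : nat) : seq K :=
  if n is n'.+1 then
    let s := linv_seq a n' in
    rcons s (- (a 0%N)^-1 * \sum_(i < n) a (n - i)%N * s`_i)
  else [:: (a 0%N)^-1].

Lemma size_linv_seq a n : size (linv_seq a n) = n.+1.
Proof. by elim: n => //= n IHn; rewrite size_rcons IHn. Qed.

Definition linv_coef a n := (linv_seq a n)`_n.

Lemma linv_seqE a n i : (i <= n)%N -> (linv_seq a n)`_i = linv_coef a i.
Proof.
elim: n => [|n IHn]; first by rewrite leqn0 => /eqP->.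
rewrite leq_eqVlt => /orP[/eqP->//|lt_in] /=.
by rewrite nth_rcons size_linv_seq lt_in IHn.
Qed.

Lemma linv_coefS a n : linv_coef a n.+1 =
  - (a 0%N)^-1 * \sum_(i < n.+1) a (n.+1 - i)%N * linv_coef a i.
Proof.
rewrite {1}/linv_coef /= nth_rcons size_linv_seq ltnn eqxx.
by congr (_ * _); apply: eq_bigr => i _; rewrite linv_seqE// -ltnS.
Qed.

Lemma linv_coefP a n : a 0%N != 0 ->
  \sum_(j < n.+1) linv_coef a j * a (n - j)%N = (n == 0%N)%:R.
Proof.
move=> a0; case: n => [|n].
  by rewrite big_ord_recl big_ord0 addr0 /linv_coef /= mulVf.
rewrite big_ord_recr /= subnn linv_coefS mulrAC mulNr mulVf// mulN1r.
by apply/eqP; rewrite subr_eq0; apply/eqP/eq_bigr => i _; rewrite mulrC.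
Qed.

Lemma linv_exists x : x != 0 -> exists y, y * x = 1.
Proof.
move=> /lorder_exists[m [xm x0]].
pose a (n : nat) := lcoef x (m + n%:Z).
have a0 : a 0%N != 0 by rewrite /a addr0.
pose f (n : int) := if n < - m then 0 else linv_coef a `|(n + m)%R|%N.
have f0 : vanishes_below f (- m) by move=> n nm; rewrite /f nm.
exists (Laurent (ex_intro _ _ f0)); apply: laurentP => n.
have -> : lcoef (1 : laurent) n = (n == 0)%:R by rewrite /= /ldelta; case: eqP.
have [nlt|nge] := ltP n 0.
  by rewrite /= (conv_vanishes f0 x0) ?addNr// lt_eqF.
have [k ->] := lge_nat nge.
rewrite -[X in lcoef _ (X + _)](addNr m) /= (convE _ f0 x0) add0r eqz_nat.
rewrite -(linv_coefP _ a0); apply: eq_bigr => -[j /= _] _; congr (_ * _).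
by rewrite /f ltNge lerDl /= addrAC addNr add0r.
Qed.

Definition linv x : laurent := xget 0 [set y | x != 0 /\ y * x = 1].

Lemma linvP x : x != 0 -> linv x * x = 1.
Proof.
move=> x0; rewrite /linv; case: xgetP => [y _ []//|].
by have [y yx] := linv_exists x0 => /(_ y) []; split.
Qed.

Lemma linv0 : linv 0 = 0.
Proof. by rewrite /linv; case: xgetP => // y _ [] /eqP. Qed.

HB.instance Definition _ := GRing.ComNzRing_isField.Build laurent linvP linv0.

End Laurent.

(* The order of vanishing at t = 0. *)
Definition lval (K : fieldType) (x : laurent K) : \bar int :=
  if x == 0 then +oo%E else (xget (0 : int) [set n | lorder_spec x n])%:E.

Section Valuation.
Local Open Scope ereal_scope.

(* v is a normalized discrete valuation on the subfield E; its values
   outside E are irrelevant. *)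
Definition normalized_valuation (F : fieldType) (E : {pred F})
    (v : F -> \bar int) : Prop :=
  [/\ {in E, forall x, v x != -oo /\ (v x = +oo <-> x = 0%R)},
      {in E &, forall x y, v (x * y)%R = v x + v y},
      {in E &, forall x y, Order.min (v x) (v y) <= v (x + y)%R} &
      forall n : int, exists2 x, x \in E & v x = n%:E].

Definition to_ratbar (x : \bar int) : \bar rat := er_map (intr : int -> rat) x.

End Valuation.

Lemma lvalE (K : fieldType) (x : laurent K) n :
  lorder_spec x n -> lval x = n%:E.
Proof.
move=> xn; rewrite /lval; case: eqP => [x0|_].
  by case: xn; rewrite x0 /= eqxx.
by case: xgetP => [m _ /(lorder_uniq xn)->//|/(_ n)].
Qed.

Lemma lval_lmono (K : fieldType) m (c : K) : c != 0 -> lval (lmono m c) = m%:E.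
Proof.
move=> c0; apply: lvalE; split; last exact: ldelta_vanishes.
by rewrite /= /ldelta eqxx.
Qed.

Lemma lval_normalized (K : fieldType) :
  normalized_valuation predT (@lval K).
Proof.
have val0 : lval (0 : laurent K) = +oo%E by rewrite /lval eqxx.
split.
- move=> x _; have [->|x0] := eqVneq x 0; first by rewrite val0.
  have [n /lvalE->] := lorder_exists x0; split=> //; split=> // xE.
  by rewrite xE eqxx in x0.
- move=> x y _ _; have [->|x0] := eqVneq x 0.
    rewrite mul0r val0; have [->|/lorder_exists[n /lvalE->]//] := eqVneq y 0.
    by rewrite val0.
  have [->|y0] := eqVneq y 0.
    by rewrite mulr0 val0; have [n /lvalE->] := lorder_exists x0.
  have [n xn] := lorder_exists x0; have [m ym] := lorder_exists y0.
  rewrite (lvalE xn) (lvalE ym) -EFinD; apply: lvalE.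
  case: xn ym => [xn xb] [ym yb]; split; last exact: conv_vanishes.
  have := convE 0 xb yb; rewrite addr0 => /= ->.
  by rewrite big_ord1 !addr0 mulf_neq0.
- move=> x y _ _; have [->|x0] := eqVneq x 0.
    by rewrite add0r ge_min lexx orbT.
  have [->|y0] := eqVneq y 0; first by rewrite addr0 ge_min lexx.
  have [->|s0] := eqVneq (x + y) 0; first by rewrite val0 leey.
  have [n xn] := lorder_exists x0; have [m ym] := lorder_exists y0.
  have [k sk] := lorder_exists s0.
  rewrite (lvalE xn) (lvalE ym) (lvalE sk) ge_min !lee_fin -ge_min leNgt.
  rewrite lt_min; apply/negP => /andP[kn km].
  by case: xn ym sk => [_ xb] [_ yb] [/eqP[]]; rewrite /= xb// yb// addr0.
- move=> n; exists (lmono n 1) => //.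
  by rewrite lval_lmono// oner_neq0.
Qed.

Definition wp (p : nat) (R : nzRingType) (x : R) : R := x ^+ p - x.

Definition in_wp (p : nat) (R : nzRingType) (y : R) : Prop :=
  exists k : R, y = wp p k.

Definition gbinom (F : fieldType) (x : F) (i : nat) : F :=
  (\prod_(j < i) (x - j%:R)) / (i`!)%:R.

Section GroupAlgebra.
Variables (R : nzRingType) (gT : finGroupType).

(* The group ring R[gT], under convolution. *)
Definition galgebra : Type := {ffun gT -> R}.
HB.instance Definition _ := GRing.Lmodule.copy galgebra {ffun gT -> R^o}.

Implicit Types a b c : galgebra.

Definition gbasis (g : gT) : galgebra := [ffun h => (h == g)%:R].

Definition gmul a b : galgebra :=
  [ffun g : gT => \sum_(h : gT) a h * b (h^-1 * g)%g].

Lemma gmulA : associative gmul.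
Proof.
move=> a b c; apply/ffunP => g; rewrite !ffunE.
under eq_bigr do rewrite ffunE mulr_sumr.
under [RHS]eq_bigr do rewrite ffunE mulr_suml.
rewrite [RHS]exchange_big; apply: eq_bigr => h _ /=.
rewrite [RHS](reindex_inj (mulgI h)) /=; apply: eq_bigr => k _.
by rewrite mulKg invMg mulgA mulrA.
Qed.

Lemma gmul1 : left_id (gbasis 1%g) gmul.
Proof.
move=> a; apply/ffunP => g; rewrite ffunE (bigD1 1%g)//= ffunE eqxx mul1r.
rewrite invg1 mul1g big1 ?addr0// => h /negPf h1.
by rewrite ffunE h1 mul0r.
Qed.

Lemma gmulr1 : right_id (gbasis 1%g) gmul.
Proof.
move=> a; apply/ffunP => g; rewrite ffunE (bigD1 g)//= ffunE mulVg eqxx mulr1.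
rewrite big1 ?addr0// => h hg; rewrite ffunE -eq_mulVg1 (negPf hg).
by rewrite mulr0.
Qed.

Lemma gmulDl : left_distributive gmul +%R.
Proof.
move=> a b c; apply/ffunP => g; rewrite !ffunE -big_split.
by apply: eq_bigr => h _; rewrite ffunE mulrDl.
Qed.

Lemma gmulDr : right_distributive gmul +%R.
Proof.
move=> a b c; apply/ffunP => g; rewrite !ffunE -big_split.
by apply: eq_bigr => h _; rewrite ffunE mulrDr.
Qed.

Lemma gone_neq0 : gbasis 1%g != 0.
Proof.
apply/eqP => /ffunP/(_ 1%g); rewrite !ffunE eqxx => /eqP.
by rewrite oner_eq0.
Qed.

HB.instance Definition _ := GRing.Zmodule_isNzRing.Build galgebra
  gmulA gmul1 gmulr1 gmulDl gmulDr gone_neq0.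

(* The left ideal generated by the g - 1; it is two-sided. *)
Definition augmentation_ideal a : Prop :=
  exists c : gT -> galgebra, a = \sum_(g : gT) c g * (gbasis g - 1).

End GroupAlgebra.

Section Extension.
Variables (F : fieldType) (L : splittingFieldType F).
Implicit Types (v : L -> \bar int) (U E : {subfield L}).
Local Open Scope ereal_scope.

(* (s * t)%g x = t (s x) in gal_of, so for noncommutative groups this is a
   right action. *)
Definition galgebra_act (a : galgebra F (gal_of {:L})) (x : L) : L :=
  (\sum_(s : gal_of {:L}) a s *: s x)%R.

(* Here v is the normalized valuation of E. *)
Definition ramification_group v U E (i : nat) : {set gal_of E} :=
  [set s in 'Gal(E / U)%g |
    `[< forall x, x \in E -> 0 <= v x -> (i.+1)%:Z%:E <= v (s x - x)%R >]].

(* s is the list with multiplicity of the lower ramification numbers of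
   E / U, the multiplicity of i being log_p [G_i : G_(i+1)].  Starting at
   i = 0 loses nothing for a totally ramified extension. *)
Definition lower_ramification_numbers (p : nat) v U E (s : seq nat) : Prop :=
  sorted leq s /\ forall i : nat,
    #|ramification_group v U E i| =
      (p ^ count_mem i s * #|ramification_group v U E i.+1|)%N.

Definition complete_residues (m : nat) (S : set (\bar int)) : Prop :=
  (forall y, S y -> y \is a fin_num) /\
  forall n : int, exists! k : int, S k%:E /\ (k = n %[mod m%:Z])%Z.

(* v(x) is finite and congruent to b modulo m. *)
Definition val_congr v (m b : nat) (x : L) : Prop :=
  exists2 n : int, v x = n%:E & (n = b%:Z %[mod m%:Z])%Z.

Definition galois_scaffold (p : nat) v (b2 : nat)
    (Psi1 Psi2 : galgebra F (gal_of {:L})) : Prop :=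
  [/\ augmentation_ideal Psi1, augmentation_ideal Psi2,
      forall Psi, Psi = Psi1 \/ Psi = Psi2 ->
      forall (j : nat) (rho rho' : L), (j < p)%N ->
        val_congr v (p ^ 2) b2 rho -> val_congr v (p ^ 2) b2 rho' ->
        v (galgebra_act (Psi ^+ j)%R rho) - v rho =
          j%:Z%:E * (v (galgebra_act Psi rho') - v rho') &
      forall rho : L, val_congr v (p ^ 2) b2 rho ->
        complete_residues (p ^ 2)
          [set v (galgebra_act (Psi2 ^+ a.1 * Psi1 ^+ a.2)%R rho)
            | a in [set: 'I_p * 'I_p]]].

End Extension.

Section Description.
Variables (K : fieldType) (p : nat) (L : splittingFieldType (laurent K)).
Variables (b1 : nat) (beta1 beta2 : laurent K) (x1 x2 : L).
Variables (sigma1 sigma2 : gal_of {:L}).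
Local Notation G := ('Gal({:L} / 1))%g.
Local Notation v0 := (@lval K).

(* F_p y is the set of y *+ c with c < p. *)
Definition elementary_abelian_data : Prop :=
  [/\ G \isog [set: 'Z_p * 'Z_p],
      [/\ wp p x1 = beta1%:A, wp p x2 = beta2%:A &
          <<1 & [:: x1; x2]>>%VS = {:L}%VS],
      [/\ forall c1 c2 : 'I_p, in_wp p (beta1 *+ c1 + beta2 *+ c2) ->
            c1 = 0%N :> nat /\ c2 = 0%N :> nat,
          forall (c1 c2 : 'I_p) (k : laurent K),
            let y := beta1 *+ c1 + beta2 *+ c2 + wp p k in
            ~ in_wp p y -> (v0 y <= v0 beta1)%E &
          forall (c : 'I_p) (k : laurent K),
            (v0 (beta2 + beta1 *+ c + wp p k)%R <= v0 beta2)%E],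
      (v0 beta1 = (- b1%:Z)%:E /\ ~~ (p %| b1)%N) &
      [/\ sigma1 x1 - x1 = 1, sigma1 x2 - x2 = 0,
          sigma2 x1 - x1 = 0 & sigma2 x2 - x2 = 1]].

(* The coefficient 'C(p, i) / p is an integer for 0 < i < p. *)
Definition D1 : L :=
  - \sum_(1 <= i < p) (x1 ^+ i * beta1%:A ^+ (p - i)) *+ ('C(p, i) %/ p).

Definition cyclic_data : Prop :=
  [/\ G \isog [set: 'Z_(p ^ 2)],
      [/\ wp p x1 = beta1%:A, wp p x2 = D1 + beta2%:A &
          <<1; x2>>%VS = {:L}%VS],
      ((forall k, (v0 (beta1 + wp p k)%R <= v0 beta1)%E) /\
       forall (c : 'I_p) (k : laurent K),
         (v0 (beta2 + beta1 *+ c + wp p k)%R <= v0 beta2)%E),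
      [/\ v0 beta1 = (- b1%:Z)%:E, (0 < b1)%N & ~~ (p %| b1)%N] &
      [/\ G = <[sigma1]>%g, sigma1 x1 - x1 = 1,
          sigma2 = (sigma1 ^+ p)%g & sigma2 x2 - x2 = 1]].

End Description.

Section Psi.
Variables (F : fieldType) (p : nat) (gT : finGroupType) (mu : F).

Definition truncated_power (s : gT) : galgebra F gT :=
  \sum_(i < p) gbinom mu i *: (gbasis F s - 1) ^+ i.

End Psi.

(* Main.v *)
(* Put y = x2 - mu x1, so that s2 y = y + 1, and m = b1 - p^2 v0(mu). The bound
   on epsilon makes mu^p x1 the dominant term of wp(y), whence v2(y) = -m with
   m prime to p. As v2(x1) = -p b1, the products 'C(y, i) 'C(x1, j), i, j < p,
   have valuations -(i m + j p b1), distinct modulo p^2: they form a K0-basis of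
   K2 in which valuations are read off termwise. Pascal's rule shows that Psi2
   lowers i by one, and then the definition of the ramification numbers gives
   b2 = m. By Vandermonde's identity s2^[mu] translates y by mu, which undoes
   the action of s1 on y up to delta = s1 x2 - x2; hence Psi1 lowers j by one,
   exactly if delta = 0 (the elementary abelian case) and up to terms of higher
   valuation in the cyclic case. Finally an element of valuation congruent to b2
   has its leading term at i = j = p - 1, the only index from which all powers
   of Psi1 and Psi2 below p survive. *)
Require Import Defs.
From HB Require Import structures.
From mathcomp Require Import all_boot all_order all_algebra all_fingroup.
From mathcomp Require Import all_solvable all_field.
From mathcomp Require Import mathcomp_extra boolp classical_sets functions.
From mathcomp Require Import cardinality fsbigop constructive_ereal.
From mathcomp Require Import ring zify.

Set Implicit Arguments.
Unset Strict Implicit.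
Unset Printing Implicit Defensive.

Import Order.TTheory GRing.Theory Num.Theory.
Local Open Scope ring_scope.

(** * Calculus of a normalized discrete valuation on a field *)

Section ValuedField.
Variables (F : fieldType) (v : F -> \bar int).
Hypothesis v_norm : normalized_valuation predT v.
Implicit Types (x y : F) (m n : int) (k : nat).

Lemma val_eqy x : v x = +oo%E <-> x = 0.
Proof. by case: v_norm => /(_ x isT)[]. Qed.

Lemma valuation0 : v 0 = +oo%E. Proof. exact/val_eqy. Qed.

Lemma valuationM x y : v (x * y) = (v x + v y)%E.
Proof. by case: v_norm => _ + _ _; apply. Qed.

Lemma val_fin x : x != 0 -> exists n, v x = n%:E.
Proof.
move=> x0; case: v_norm => /(_ x isT)[+ xE] _ _ _.
case: (v x) xE => [n|[xE _]|_ /eqP//]; first by exists n.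
by rewrite xE ?eqxx in x0.
Qed.

Lemma val_neq0 x n : v x = n%:E -> x != 0.
Proof. by move=> xn; apply/eqP => x0; rewrite x0 valuation0 in xn. Qed.

Lemma val_mul x y m n : v x = m%:E -> v y = n%:E -> v (x * y) = (m + n)%:E.
Proof. by rewrite valuationM => -> ->. Qed.

Lemma valuation1 : v 1 = 0%:E.
Proof.
have [n n1] := val_fin (oner_neq0 F).
have := val_mul n1 n1; rewrite mulr1 n1 => -[nn].
by congr EFin; apply: (addrI n); rewrite -nn addr0.
Qed.

Lemma val_exp x n k : v x = n%:E -> v (x ^+ k) = (k%:Z * n)%:E.
Proof.
move=> xn; elim: k => [|k IHk]; first by rewrite valuation1 mul0r.
by rewrite exprS (val_mul xn IHk); congr EFin; rewrite intS mulrDl mul1r.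
Qed.

(** Holds because $(-x)^2=x^2$ and doubling is injective on the integers. *)
Lemma valuationN x : v (- x) = v x.
Proof.
have [->|x0] := eqVneq x 0; first by rewrite oppr0.
have Nx0 : - x != 0 by rewrite oppr_eq0.
have [n xn] := val_fin x0; have [m xm] := val_fin Nx0.
have := val_mul xm xm; rewrite mulrNN (val_mul xn xn) xn xm => -[nm].
by congr EFin; lia.
Qed.

Lemma val_geD x y n : (n%:E <= v x -> n%:E <= v y -> n%:E <= v (x + y)%R)%E.
Proof.
move=> nx ny; case: v_norm => _ _ /(_ x y isT isT) + _; apply: le_trans.
by rewrite le_min nx.
Qed.

Lemma val_ge0 n : (n%:E <= v 0)%E. Proof. by rewrite valuation0 leey. Qed.

Lemma val_geB x y n : (n%:E <= v x -> n%:E <= v y -> n%:E <= v (x - y)%R)%E.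
Proof. by move=> nx ny; apply: val_geD; rewrite ?valuationN. Qed.

Lemma val_ge_sum (I : Type) (r : seq I) (P : pred I) (f : I -> F) n :
  (forall i, P i -> (n%:E <= v (f i))%E) ->
  (n%:E <= v (\sum_(i <- r | P i) f i))%E.
Proof.
by move=> nf; elim/big_ind: _ => //; [apply: val_ge0|move=> *; apply: val_geD].
Qed.

Lemma val_geM x y m n :
  (m%:E <= v x -> n%:E <= v y -> (m + n)%:E <= v (x * y)%R)%E.
Proof. by rewrite valuationM EFinD; apply: leeD. Qed.

Lemma val_geW x m n : n <= m -> (m%:E <= v x -> n%:E <= v x)%E.
Proof. by move=> nm; apply: le_trans; rewrite lee_fin. Qed.

Lemma val_ge x m n : v x = m%:E -> n <= m -> (n%:E <= v x)%E.
Proof. by move=> ->; rewrite lee_fin. Qed.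

Lemma val_ge_mulrn x n k : (n%:E <= v x -> n%:E <= v (x *+ k))%E.
Proof.
move=> nx; elim: k => [|k IHk]; first exact: val_ge0.
by rewrite mulrS; apply: val_geD.
Qed.

Lemma val_ge_nat k : (0%:E <= v k%:R)%E.
Proof. by apply: val_ge_mulrn; rewrite valuation1. Qed.

Lemma val_geX x n k : (n%:E <= v x -> (k%:Z * n)%:E <= v (x ^+ k)%R)%E.
Proof.
move=> nx; elim: k => [|k IHk]; first by rewrite valuation1 mul0r.
rewrite exprS; apply: val_geW (val_geM nx IHk).
by rewrite intS mulrDl mul1r.
Qed.

(** If the sum had larger valuation, so would $x=(x+y)-y$. *)
Lemma val_addl x y n : v x = n%:E -> ((n + 1)%:E <= v y)%E ->
  v (x + y) = n%:E.
Proof.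
move=> xn ny; have nxy : (n%:E <= v (x + y))%E.
  by apply: val_geD; rewrite ?xn//; apply: val_geW ny; lia.
have [xy0|/val_fin[m xym]] := eqVneq (x + y) 0.
  have yx : y = - x by apply/eqP; rewrite -addr_eq0 addrC xy0.
  by move: ny; rewrite yx valuationN xn lee_fin; lia.
rewrite xym lee_fin in nxy *; congr EFin; apply/eqP; rewrite eq_le nxy andbT.
rewrite leNgt; apply/negP => nm; have : ((n + 1)%:E <= v (x + y - y)%R)%E.
  by apply: val_geB => //; rewrite xym lee_fin; lia.
by rewrite addrK xn lee_fin; lia.
Qed.

Lemma val_ge_next x n : (n%:E <= v x)%E -> v x <> n%:E ->
  ((n + 1)%:E <= v x)%E.
Proof.
have [->|/val_fin[m ->]] := eqVneq x 0; first by move=> _ _; apply: val_ge0.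
rewrite !lee_fin => nm mn; have : m != n by apply: contra_notN mn => /eqP->.
by lia.
Qed.

(** A negative valuation of $y$ makes $y^p$ strictly dominate $y$, while an integral $y$ has
    integral image. This recovers $v(y)$ from an Artin-Schreier equation. *)
Lemma val_wp (p : nat) y n : (1 < p)%N -> n < 0 ->
  v (wp p y) = (p%:Z * n)%:E -> v y = n%:E.
Proof.
move=> p1 n0; rewrite /wp.
have [->|/val_fin[k yk]] := eqVneq y 0.
  by rewrite expr0n gtn_eqF ?subr0 ?valuation0//; lia.
have [k0|k0] := leP 0 k.
  have : (0%:E <= v (y ^+ p - y)%R)%E.
    apply: val_geB; last by rewrite yk lee_fin.
    by rewrite (val_exp _ yk) lee_fin mulr_ge0.
  by move=> + e; rewrite e lee_fin; nia.
rewrite (@val_addl _ _ (p%:Z * k)) ?(val_exp _ yk)//.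
  by rewrite yk => -[/mulfI->//]; lia.
by rewrite valuationN yk lee_fin; nia.
Qed.

Lemma val_ge_wp (p : nat) y n : (1 < p)%N -> n <= 0 ->
  ((p%:Z * n)%:E <= v (wp p y) -> n%:E <= v y)%E.
Proof.
move=> p1 n0; rewrite /wp.
have [->|/val_fin[k yk]] := eqVneq y 0; first by rewrite valuation0 leey.
have [k0|k0] := leP 0 k; first by rewrite yk lee_fin => _; lia.
rewrite (@val_addl _ _ (p%:Z * k)) ?(val_exp _ yk)//.
  by rewrite yk !lee_fin; nia.
by rewrite valuationN yk lee_fin; nia.
Qed.

(* Terms of pairwise distinct valuations cannot cancel. *)
Lemma val_ge_terms (I : finType) (y : I -> F) n :
  (forall i j m, v (y i) = m%:E -> v (y j) = m%:E -> i = j) ->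
  (n%:E <= v (\sum_i y i))%E -> forall i, (n%:E <= v (y i))%E.
Proof.
move=> y_inj ny i; rewrite leNgt; apply/negP => yi_lt.
have [j _ jmin] := @Order.TotalTheory.arg_minP _ _ I i xpredT (v \o y) isT.
have yj_lt : (v (y j) < n%:E)%E by apply: le_lt_trans yi_lt; apply: jmin.
have [m ym] : exists m, v (y j) = m%:E.
  apply: val_fin; apply/eqP => yj0.
  by rewrite yj0 valuation0 ltNge leey in yj_lt.
have : v (\sum_i y i) = m%:E.
  rewrite (bigD1 j)//=; apply: val_addl => //; apply: val_ge_sum => k kj.
  apply: val_ge_next; first by rewrite -ym; apply: jmin.
  by move=> ykm; rewrite (y_inj _ _ _ ykm ym) eqxx in kj.
by move=> e; rewrite e -ym leNgt yj_lt in ny.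
Qed.

End ValuedField.

(** * Generalized binomial coefficients of degree below $p$ in characteristic $p$ *)

Section GeneralizedBinomial.
Variables (F : fieldType) (p : nat).
Hypothesis F_pchar : p \in [pchar F].
Implicit Types (x y : F) (n : nat).

Let p_prime : prime p. Proof. by case/andP: F_pchar. Qed.

Lemma natf_neq0_lt n : (n.+1 < p)%N -> n.+1%:R != 0 :> F.
Proof. by move=> np; rewrite -(dvdn_pcharf F_pchar) gtnNdvd. Qed.

Lemma factf_neq0 n : (n < p)%N -> n`!%:R != 0 :> F.
Proof.
elim: n => [|n IHn] np; first by rewrite fact0 oner_neq0.
by rewrite factS natrM mulf_neq0 ?natf_neq0_lt// IHn// ltnW.
Qed.

Lemma gbinom0 x : gbinom x 0 = 1.
Proof. by rewrite /gbinom big_ord0 fact0 divr1. Qed.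

Lemma gbinomS x n : (n.+1 < p)%N ->
  n.+1%:R * gbinom x n.+1 = (x - n%:R) * gbinom x n.
Proof.
move=> np; rewrite /gbinom factS natrM big_ord_recr /=.
move: (n.+1%:R : F) (natf_neq0_lt np) => a a0.
by move: (n`!%:R : F) (factf_neq0 (ltnW np)) => b b0; field; rewrite a0 b0.
Qed.

Lemma gbinom0S n : gbinom (0 : F) n.+1 = 0.
Proof. by rewrite /gbinom big_ord_recl subrr mul0r mul0r. Qed.

(** Induction on $n$ through $(n+1)\binom{z}{n+1}=(z-n)\binom{z}{n}$, splitting $x+y-n$ as
    $(x-k)+(y-(n-k))$. The bound [n < p] keeps the cancelled factors nonzero. *)
Lemma gbinom_Vandermonde x y n : (n < p)%N ->
  gbinom (x + y) n = \sum_(k < n.+1) gbinom x k * gbinom y (n - k).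
Proof.
elim: n => [|n IHn] np; first by rewrite big_ord1 !gbinom0 mulr1.
apply: (mulfI (natf_neq0_lt np)); rewrite gbinomS// IHn ?(ltnW np)//.
transitivity (\sum_(k < n.+2) (k%:R * gbinom x k * gbinom y (n.+1 - k)
   + gbinom x k * ((n.+1 - k)%N%:R * gbinom y (n.+1 - k)))).
  rewrite big_split /= [in RHS]big_ord_recl /= mul0r mul0r add0r.
  rewrite [X in _ = _ + X]big_ord_recr /= subnn mul0r mulr0 addr0.
  rewrite -big_split mulr_sumr; apply: eq_bigr => -[k /= kn] _.
  rewrite subSS subSn//= !gbinomS ?(leq_ltn_trans _ np)//.
  - by rewrite -[X in x + y - X%:R](subnKC (kn : k <= n)%N) natrD; ring.
  - exact: leq_subr.
rewrite mulr_sumr; apply: eq_bigr => -[k /= kn] _.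
have -> : n.+1%:R = k%:R + (n.+1 - k)%N%:R :> F by rewrite -natrD subnKC.
by move: (n.+1 - k)%N => m; ring.
Qed.

(** Vandermonde with one argument equal to 1, where $\binom{1}{k}=0$ for $k\ge 2$. *)
Lemma gbinom_Pascal x n : (n.+1 < p)%N ->
  gbinom (x + 1) n.+1 = gbinom x n.+1 + gbinom x n.
Proof.
have b1 : gbinom (1 : F) 1 = 1 by rewrite /gbinom big_ord1 subr0 divr1.
have b2 k : gbinom (1 : F) k.+2 = 0.
  by rewrite /gbinom !big_ord_recl /= subrr mul0r mulr0 mul0r.
move=> np; rewrite addrC gbinom_Vandermonde// !big_ord_recl /= /bump /=.
rewrite gbinom0 mul1r subn0 subn1 b1 mul1r big1 ?addr0// => k _.
by rewrite b2 mul0r.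
Qed.

End GeneralizedBinomial.

Lemma gbinom_alg (F : fieldType) (L : fieldExtType F) (a : F) n :
  (gbinom a n)%:A = gbinom (a%:A : L) n.
Proof.
rewrite /gbinom -[LHS]/(in_alg L _) rmorphM fmorphV rmorph_nat rmorph_prod.
by congr (_ / _); apply: eq_bigr => i _; rewrite rmorphB rmorph_nat.
Qed.

Lemma gbinom_rmorph (F L : fieldType) (f : {rmorphism F -> L}) (x : F) n :
  f (gbinom x n) = gbinom (f x) n.
Proof.
rewrite /gbinom rmorphM fmorphV rmorph_nat rmorph_prod.
by congr (_ / _); apply: eq_bigr => i _; rewrite rmorphB rmorph_nat.
Qed.

(** * Valuations of generalized binomial coefficients *)

Section BinomialValuation.
Variables (F : fieldType) (p : nat) (v : F -> \bar int).
Hypothesis F_pchar : p \in [pchar F].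
Hypothesis v_norm : normalized_valuation predT v.
Implicit Types (x y : F) (n : int) (k : nat).

Let p_gt1 : (1 < p)%N. Proof. by apply: prime_gt1; case/andP: F_pchar. Qed.

(** Frobenius fixes the prime field, so $v(k)=p\,v(k)$. *)
Lemma val_nat k : k%:R != 0 :> F -> v k%:R = 0%:E.
Proof.
move=> k0; have [n kn] := val_fin v_norm k0.
have := val_exp v_norm p kn.
rewrite -[_ ^+ p]/(pFrobenius_aut F_pchar _) rmorph_nat kn => -[np].
by congr EFin; move: p_gt1 np; nia.
Qed.

(** Each factor $x-j$ keeps the negative valuation of $x$, and the factorial in the denominator is a
    unit. *)
Lemma val_gbinom x n k : (k < p)%N -> n < 0 -> v x = n%:E ->
  v (gbinom x k) = (k%:Z * n)%:E.
Proof.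
move=> kp n0 xn; have k0 := factf_neq0 F_pchar kp.
suff <- : v (gbinom x k * k`!%:R) = (k%:Z * n)%:E.
  by rewrite valuationM// val_nat// adde0.
rewrite /gbinom divfK//; elim: k {kp k0} => [|k IHk].
  by rewrite big_ord0 mul0r valuation1.
rewrite big_ord_recr /=.
have xk : v (x - k%:R) = n%:E.
  apply: val_addl => //; rewrite valuationN//.
  apply: val_geW (val_ge_nat v_norm k).
  by lia.
by rewrite (val_mul v_norm IHk xk); congr EFin; rewrite intS; ring.
Qed.

Lemma val_ge_gbinom x n k : (k < p)%N -> n <= 0 -> (n%:E <= v x)%E ->
  ((k%:Z * n)%:E <= v (gbinom x k))%E.
Proof.
move=> kp n0 xn; have k0 := factf_neq0 F_pchar kp.
suff : ((k%:Z * n)%:E <= v (gbinom x k * k`!%:R)%R)%E.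
  by rewrite valuationM// val_nat// adde0.
rewrite /gbinom divfK//; elim: k {kp k0} => [|k IHk].
  by rewrite big_ord0 mul0r valuation1.
rewrite big_ord_recr /= intS mulrDl mul1r addrC; apply: val_geM => //.
by apply: val_geB => //; apply: val_geW (val_ge_nat v_norm k).
Qed.

End BinomialValuation.

(** * Bases whose valuations are distinct modulo the ramification index *)

Section BasisExpansion.
Variables (F : fieldType) (L : fieldExtType F).
Variables (v0 : F -> \bar int) (v : L -> \bar int) (N : nat).
Hypothesis v0_norm : normalized_valuation predT v0.
Hypothesis v_norm : normalized_valuation predT v.
Hypothesis v_ram : forall a : F, v a%:A = (N%:Z%:E * v0 a)%E.
Implicit Types (a : F) (x : L) (m n : int).

Lemma val_alg a m : v0 a = m%:E -> v a%:A = (N%:Z * m)%:E.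
Proof. by move=> am; rewrite v_ram am -EFinM. Qed.

Lemma val_scale a x m n : v0 a = m%:E -> v x = n%:E ->
  v (a *: x) = (N%:Z * m + n)%:E.
Proof.
by move=> am xn; rewrite -mulr_algl (val_mul v_norm (val_alg am) xn).
Qed.

Lemma val_scale_congr a x m n : v x = m%:E -> v (a *: x) = n%:E ->
  (n = m %[mod N%:Z])%Z.
Proof.
move=> xm axn; have [k ak] : exists k, v0 a = k%:E.
  apply: val_fin => //; apply/eqP => a0.
  by rewrite a0 scale0r valuation0 in axn.
by move: axn; rewrite (val_scale ak xm) => -[<-]; rewrite mulrC modzMDl.
Qed.

Variables (I : finType) (e : I -> L) (w : I -> int).
Hypothesis e_val : forall i, v (e i) = (w i)%:E.
Hypothesis w_inj : forall i j, (w i = w j %[mod N%:Z])%Z -> i = j.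

Lemma val_terms_inj (a : I -> F) i j n :
  v (a i *: e i) = n%:E -> v (a j *: e j) = n%:E -> i = j.
Proof.
move=> /(val_scale_congr (e_val i)) ni /(val_scale_congr (e_val j)) nj.
by apply: w_inj; rewrite -ni -nj.
Qed.

Hypothesis dimL : #|I| = \dim {:L}.

(** Terms from distinct residue classes cannot cancel, so in a vanishing combination every term has
    arbitrarily large valuation and is 0. The family is thus free, and the dimension count makes it
    a basis. *)
Lemma basis_expand x : exists a : I -> F, x = \sum_i a i *: e i.
Proof.
pose X := [tuple e (enum_val i) | i < #|I|].
have XE (i : 'I_#|I|) : X`_i = e (enum_val i) by rewrite -tnth_nth tnth_mktuple.
have freeX : free X.
  apply/freeP => k k0 i; pose a j := k (enum_rank j).
  have a0 : \sum_j a j *: e j = 0.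
    rewrite -[RHS]k0 [RHS](reindex_onto enum_rank enum_val) /=; last first.
      by move=> j _; apply: enum_valK.
    by apply: eq_big => [j|j _]; rewrite ?enum_rankK ?eqxx// XE enum_rankK.
  have aE0 n : (n%:E <= v (a (enum_val i) *: e (enum_val i)))%E.
    apply: (val_ge_terms v_norm (y := fun j => a j *: e j)).
      exact: val_terms_inj.
    by rewrite a0 valuation0 ?leey.
  apply/eqP; apply: contraT => ki0; rewrite /a enum_valK in aE0.
  have : k i *: e (enum_val i) != 0.
    by rewrite scaler_eq0 negb_or ki0 (val_neq0 v_norm (e_val _)).
  move=> /(val_fin v_norm)[n kn]; have := aE0 (n + 1).
  by rewrite kn lee_fin; lia.
have basisX : basis_of fullv X.
  by rewrite basisEfree freeX subvf size_tuple dimL leqnn.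
exists (fun j => coord X (enum_rank j) x).
rewrite {1}(coord_basis basisX (memvf x)) 
  [LHS](reindex_onto enum_rank enum_val) /=; last first.
  by move=> i _; apply: enum_valK.
by apply: eq_big => [i|i _]; rewrite ?enum_rankK ?eqxx// XE enum_rankK.
Qed.

Lemma basis_expand_ge x n : (n%:E <= v x)%E ->
  exists2 a : I -> F, x = \sum_i a i *: e i &
    forall i, (n%:E <= v (a i *: e i))%E.
Proof.
move=> nx; have [a xE] := basis_expand x; exists a => // i.
apply: (val_ge_terms v_norm (y := fun j => a j *: e j)); last by rewrite -xE.
exact: val_terms_inj.
Qed.

(** Some term attains the valuation of the sum, as otherwise the sum would lie higher. Distinct
    residues make it unique and put the remainder strictly above. *)
Lemma basis_leading_term x n : v x = n%:E ->
  exists i a r, [/\ x = a *: e i + r, v (a *: e i) = n%:E &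
    ((n + 1)%:E <= v r)%E].
Proof.
move=> xn; have [|a xE an] := @basis_expand_ge x n; first by rewrite xn.
have [i ain] : exists i, v (a i *: e i) = n%:E.
  apply: contrapT => an_neq; suff : ((n + 1)%:E <= v x)%E.
    by rewrite xn lee_fin; lia.
  rewrite xE; apply: val_ge_sum => // i _; apply: val_ge_next => // ain.
  by apply: an_neq; exists i.
exists i, (a i), (\sum_(j | j != i) a j *: e j); split=> //.
  by rewrite xE (bigD1 i).
apply: val_ge_sum => // j ji; apply: val_ge_next => // ajn.
by rewrite (val_terms_inj ajn ain) eqxx in ji.
Qed.

(** A lower bound, rather than an equality, also covers [P x = 0] and composes by adding shifts. *)
Definition raises (P : L -> L) (s : int) :=
  forall x n, (n%:E <= v x)%E -> ((n + s)%:E <= v (P x))%E.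

Lemma raises_basis (P : {linear L -> L}) s :
  (forall i, ((w i + s)%:E <= v (P (e i)))%E) -> raises P s.
Proof.
move=> Pe x n /basis_expand_ge[a -> an]; rewrite linear_sum.
apply: val_ge_sum => // i _; rewrite linearZ /=.
have [->|a0] := eqVneq (a i) 0; first by rewrite scale0r valuation0 ?leey.
have [m am] := val_fin v0_norm a0; have := an i.
rewrite (val_scale am (e_val i)) lee_fin => nmw.
rewrite -mulr_algl; apply: val_geW (val_geM v_norm _ (Pe i)); last first.
  exact: val_ge (val_alg am) (lexx _).
by lia.
Qed.

(** Exactness on one basis vector suffices: the residue class of $v(x)$ forces the leading term of
    $x$ to be a multiple of [e i], and [raises] keeps the image of the remainder strictly above. *)
Lemma val_raises (P : {linear L -> L}) s i x n : raises P s ->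
  v (P (e i)) = (w i + s)%:E ->
  v x = n%:E -> (n = w i %[mod N%:Z])%Z -> v (P x) = (n + s)%:E.
Proof.
move=> Ps Pi xn nwi; have [j [a [r [xE an rn]]]] := basis_leading_term xn.
have nwj := val_scale_congr (e_val j) an.
have ji : j = i by apply: w_inj; rewrite -nwi -nwj.
rewrite ji in xE an; rewrite xE linearD linearZ /=; apply: val_addl => //.
  have [k ak] : exists k, v0 a = k%:E.
    apply: val_fin => //; apply/eqP => a0.
    by rewrite a0 scale0r valuation0 in an.
  rewrite (val_scale ak Pi); move: an; rewrite (val_scale ak (e_val i)).
  by move=> -[<-]; rewrite addrA.
by rewrite addrAC; apply: Ps.
Qed.

End BasisExpansion.

(** * The linear action of the group algebra *)

Lemma gal_gbinom (F : fieldType) (L : splittingFieldType F)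
    (s : gal_of {:L}) (x : L) n : s (gbinom x n) = gbinom (s x) n.
Proof. exact: (gbinom_rmorph s). Qed.

Section GroupAlgebraAction.
Variables (F : fieldType) (L : splittingFieldType F).
Local Notation gT := (gal_of {:L}).
Implicit Types (a b : galgebra F gT) (x : L).

Lemma galgebra_act_is_linear a : linear (galgebra_act a).
Proof.
move=> c x y; rewrite /galgebra_act scaler_sumr -big_split /=.
by apply: eq_bigr => s _; rewrite linearP scalerDr !scalerA mulrC.
Qed.

HB.instance Definition _ a :=
  GRing.isLinear.Build F L L *:%R (galgebra_act a) (galgebra_act_is_linear a).

Lemma galgebra_actD a b x :
  galgebra_act (a + b) x = galgebra_act a x + galgebra_act b x.
Proof.
by rewrite -big_split; apply: eq_bigr => s _; rewrite ffunE scalerDl.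
Qed.

Lemma galgebra_actN a x : galgebra_act (- a) x = - galgebra_act a x.
Proof. by rewrite -sumrN; apply: eq_bigr => s _; rewrite ffunE scaleNr. Qed.

Lemma galgebra_actB a b x :
  galgebra_act (a - b) x = galgebra_act a x - galgebra_act b x.
Proof. by rewrite galgebra_actD galgebra_actN. Qed.

Lemma galgebra_actZ c a x : galgebra_act (c *: a) x = c *: galgebra_act a x.
Proof.
rewrite /galgebra_act scaler_sumr; apply: eq_bigr => s _.
by rewrite ffunE scalerA.
Qed.

Lemma galgebra_act0 x : galgebra_act 0 x = 0.
Proof. by rewrite /galgebra_act big1 // => s _; rewrite ffunE scale0r. Qed.

Lemma galgebra_act_sum (I : Type) (r : seq I) (P : pred I)
    (f : I -> galgebra F gT) x :
  galgebra_act (\sum_(i <- r | P i) f i) x =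
  \sum_(i <- r | P i) galgebra_act (f i) x.
Proof.
apply: (big_morph (fun a => galgebra_act a x)) => [a b|].
  exact: galgebra_actD.
exact: galgebra_act0.
Qed.

Lemma galgebra_act_basis (s : gT) x : galgebra_act (gbasis F s) x = s x.
Proof.
rewrite /galgebra_act (bigD1 s)//= ffunE eqxx scale1r big1 ?addr0// => t ts.
by rewrite ffunE (negPf ts) scale0r.
Qed.

Lemma galgebra_act1 x : galgebra_act 1 x = x.
Proof. by rewrite galgebra_act_basis gal_id. Qed.

(* The order is reversed because (s * t)%g acts as t after s. *)
Lemma galgebra_actM a b x :
  galgebra_act (a * b) x = galgebra_act b (galgebra_act a x).
Proof.
rewrite {1 3}/galgebra_act linear_sum /=.
under eq_bigr => g _ do rewrite ffunE scaler_suml.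
rewrite exchange_big; apply: eq_bigr => h _ /=.
rewrite linearZ /= /galgebra_act scaler_sumr (reindex_inj (mulgI h)) /=.
apply: eq_bigr => k _.
by rewrite mulKg scalerA galM ?memvf.
Qed.

Lemma galgebra_actX a n x :
  galgebra_act (a ^+ n) x = iter n (galgebra_act a) x.
Proof.
elim: n => [|n IHn]; first exact: galgebra_act1.
by rewrite exprSr galgebra_actM IHn.
Qed.

End GroupAlgebraAction.

(** * The weights $-(im+jpb)$ modulo $p^2$ *)

Section Weights.
Variables p b m : nat.

Definition sweight (i j : nat) : int := - (i * m + j * (p * b))%N%:Z.

Lemma sweight_mod_p i j (n : int) :
  (n = sweight i j %[mod (p ^ 2)%N%:Z])%Z -> (p%:Z %| n + (i * m)%N%:Z)%Z.
Proof.
move/eqP; rewrite eqz_mod_dvd => d.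
have : (p%:Z %| n - sweight i j)%Z.
  by apply: dvdz_trans d; rewrite dvdzE /= expnS dvdn_mulr.
have -> : n - sweight i j = (n + (i * m)%N%:Z) + p%:Z * (j * b)%N%:Z.
  by rewrite /sweight; lia.
by rewrite rpredDr // dvdz_mulr.
Qed.

Hypothesis p_prime : prime p.
Hypotheses (b_ndvd : ~~ (p %| b)%N) (m_ndvd : ~~ (p %| m)%N).

(** Reduction modulo $p$ sees only the multiple of $m$, which fixes the first index. Once that part
    cancels, a factor $p$ divides out and the multiple of $b$ fixes the second. *)
Lemma sweight_inj (i j : 'I_p * 'I_p) :
  (sweight i.1 i.2 = sweight j.1 j.2 %[mod (p ^ 2)%N%:Z])%Z -> i = j.
Proof.
case: i j => [i1 i2] [j1 j2] /= /eqP; rewrite eqz_mod_dvd => d.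
have cong (k l c : nat) : (k < p)%N -> (l < p)%N -> ~~ (p %| c)%N ->
    (p%:Z %| (k * c)%N%:Z - (l * c)%N%:Z)%Z -> k = l.
  move=> kp lp pc; rewrite -eqz_mod_dvd !modz_nat => /eqP[] /eqP.
  wlog kl : k l kp lp / (k <= l)%N => [W|].
    have [|lk] := leqP k l; first exact: W.
    by rewrite eq_sym => /W kl; apply/esym/kl => //; apply: ltnW.
  rewrite eq_sym eqn_mod_dvd ?leq_mul2r ?kl ?orbT// -mulnBl Euclid_dvdM//.
  rewrite (negPf pc) orbF => /dvdnP[[|q] klE]; last by nia.
  by apply/eqP; rewrite eqn_leq kl -subn_eq0 klE.
have ij1 : i1 = j1 :> nat.
  apply: (cong _ _ m) => //.
  have : (p%:Z %| sweight i1 i2 - sweight j1 j2)%Z.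
    by apply: dvdz_trans d; rewrite dvdzE /= expnS dvdn_mulr.
  rewrite -rpredN.
  have -> : - (sweight i1 i2 - sweight j1 j2) =
    ((i1 * m)%N%:Z - (j1 * m)%N%:Z) + p%:Z * (i2%:Z - j2%:Z) * b%:Z.
    by rewrite /sweight; lia.
  by rewrite rpredDr // -mulrA dvdz_mulr.
have ij2 : i2 = j2 :> nat.
  apply: (cong _ _ b) => //; move: d; rewrite /sweight ij1 -rpredN.
  have -> : - (- (j1 * m + i2 * (p * b))%N%:Z - - (j1 * m + j2 * (p * b))%N%:Z)
    = p%:Z * ((i2 * b)%N%:Z - (j2 * b)%N%:Z) by lia.
  rewrite expnS expn1 (PoszM p p) dvdz_mul2l//.
  by move: (prime_gt1 p_prime); lia.
by congr pair; apply: val_inj.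
Qed.

End Weights.

(** * Action of $\Psi_1$ and $\Psi_2$ on the binomial basis *)

Section Scaffold.
Variables (F : fieldType) (L : splittingFieldType F) (p : nat).
Variables (v0 : F -> \bar int) (v : L -> \bar int).
Hypothesis F_pchar : p \in [pchar F].
Hypothesis v0_norm : normalized_valuation predT v0.
Hypothesis v_norm : normalized_valuation predT v.
Hypothesis v_ram : forall a : F, v a%:A = ((p ^ 2)%:Z%:E * v0 a)%E.
Hypothesis dimL : \dim {:L} = (p ^ 2)%N.

Variables (b m : nat) (mu : F) (x y delta : L) (s1 s2 : gal_of {:L}).
Hypothesis b_ndvd : ~~ (p %| b)%N.
Hypothesis m_congr : exists k : nat, m = (b + p ^ 2 * k)%N.
Hypothesis x_val : v x = (- (p * b)%N%:Z)%:E.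
Hypothesis y_val : v y = (- m%:Z)%:E.
Hypothesis s1x : s1 x = x + 1.
Hypothesis s2x : s2 x = x.
Hypothesis s1y : s1 y = y - mu%:A + delta.
Hypothesis s2y : s2 y = y + 1.
Hypothesis s2delta : s2 delta = delta.
(** Chosen so that each product $\binom{\delta}{k}\binom{y}{i-k}$ with $k>0$ exceeds $\binom{y}{i}$
    in valuation by at least $pb+1$, more than the shift $pb$ of $\Psi_1$. *)
Hypothesis delta_val : forall k, (0 < k < p)%N ->
  (((p * b)%N%:Z + 1 - (k * m)%N%:Z)%:E <= v (gbinom delta k))%E.

Local Notation Psi1 := (gbasis F s1 * truncated_power p mu s2 - 1).
Local Notation Psi2 := (gbasis F s2 - 1).

Let p_prime : prime p. Proof. by case/andP: F_pchar. Qed.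
Let p_gt1 : (1 < p)%N. Proof. exact: prime_gt1. Qed.
Let L_pchar : p \in [pchar L]. Proof. by rewrite pchar_lalg. Qed.
Let b_gt0 : (0 < b)%N.
Proof. by rewrite lt0n; apply: contraNneq b_ndvd => ->. Qed.
Let m_gt0 : (0 < m)%N.
Proof. by have [k ->] := m_congr; rewrite ltn_addr. Qed.

Lemma m_ndvd : ~~ (p %| m)%N.
Proof. by have [k ->] := m_congr; rewrite dvdn_addl// dvdn_mulr// dvdn_exp. Qed.

Local Notation sweight := (sweight p b m).

Definition sbasis (i j : nat) : L := gbinom y i * gbinom x j.

Lemma sbasis_val i j : (i < p)%N -> (j < p)%N ->
  v (sbasis i j) = (sweight i j)%:E.
Proof.
move=> ip jp; rewrite /sbasis.
rewrite (val_mul v_norm (val_gbinom L_pchar v_norm ip _ y_val)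
  (val_gbinom L_pchar v_norm jp _ x_val)).
- by congr EFin; rewrite /sweight; lia.
- by move: p_gt1 b_gt0; nia.
- by move: m_gt0; lia.
Qed.

Let se (i : 'I_p * 'I_p) := sbasis i.1 i.2.
Let sw (i : 'I_p * 'I_p) := sweight i.1 i.2.
Let sw_inj i j : (sw i = sw j %[mod (p ^ 2)%N%:Z])%Z -> i = j.
Proof. exact: (sweight_inj p_prime b_ndvd m_ndvd). Qed.
Let se_val i : v (se i) = (sw i)%:E. Proof. exact: sbasis_val. Qed.
Let cardI : #|{: 'I_p * 'I_p}| = \dim {:L}.
Proof. by rewrite card_prod card_ord dimL expnS expn1. Qed.

Lemma gbasis_sub1_act (s : gal_of {:L}) z :
  galgebra_act (gbasis F s - 1) z = s z - z.
Proof. by rewrite galgebra_actB galgebra_act_basis galgebra_act1. Qed.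

Lemma gbinom_difference z c i : s2 z = z + 1 -> s2 c = c -> (i.+1 < p)%N ->
  galgebra_act Psi2 (gbinom z i.+1 * c) = gbinom z i * c.
Proof.
move=> s2z s2c ip; rewrite gbasis_sub1_act rmorphM /= gal_gbinom s2z s2c.
by rewrite (gbinom_Pascal L_pchar)//; ring.
Qed.

Lemma gbinom0_difference z c : s2 c = c ->
  galgebra_act Psi2 (gbinom z 0 * c) = 0.
Proof. by move=> s2c; rewrite gbasis_sub1_act gbinom0 mul1r s2c subrr. Qed.

Lemma iter_gbinom_difference z c i k : s2 z = z + 1 -> s2 c = c -> (i < p)%N ->
  galgebra_act (Psi2 ^+ k) (gbinom z i * c) =
    if (k < i.+1)%N then gbinom z (i - k) * c else 0.
Proof.
move=> s2z s2c ip; rewrite galgebra_actX; elim: k => [|k IHk] /=.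
  by rewrite subn0.
rewrite IHk !ltnS {IHk}; have [ki|] := ltnP k i; last first.
  rewrite leq_eqVlt => /orP[/eqP->|ik].
    by rewrite leqnn subnn gbinom0_difference.
  by rewrite leqNgt ik linear0.
rewrite (ltnW ki) subnS.
have : (i - k < p)%N by rewrite (leq_ltn_trans _ ip)// leq_subr.
have : (0 < i - k)%N by rewrite subn_gt0.
by case: (i - k)%N => // j _ jp; apply: gbinom_difference.
Qed.

(* Vandermonde: the truncated binomial series of s2 translates y by mu. *)
Lemma truncated_power_gbinom z c i : s2 z = z + 1 -> s2 c = c -> (i < p)%N ->
  galgebra_act (truncated_power p mu s2) (gbinom z i * c) =
    gbinom (z + mu%:A) i * c.
Proof.
move=> s2z s2c ip; rewrite /truncated_power galgebra_act_sum [z + _]addrC.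
rewrite (gbinom_Vandermonde L_pchar)// mulr_suml.
rewrite (big_ord_widen p (fun k => gbinom mu%:A k * gbinom z (i - k) * c))//.
rewrite [RHS]big_mkcond; apply: eq_bigr => k _.
rewrite galgebra_actZ iter_gbinom_difference//.
rewrite -[gbinom mu k *: _]mulr_algl gbinom_alg.
by case: ifP; rewrite ?mulr0// mulrA.
Qed.

(** [s1] acts first and turns $y$ into $y-\mu+\delta$; the truncated power then adds $\mu$ back. *)
Lemma Psi1_act i j : (i < p)%N ->
  galgebra_act Psi1 (sbasis i j) =
    gbinom (y + delta) i * gbinom (x + 1) j - sbasis i j.
Proof.
move=> ip; rewrite galgebra_actB galgebra_act1 galgebra_actM galgebra_act_basis.
rewrite rmorphM /= !gal_gbinom s1x s1y truncated_power_gbinom//.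
- by congr (gbinom _ _ * _ - _); ring.
- by rewrite rmorphD rmorphB /= rmorph_alg s2y s2delta; ring.
- by rewrite gal_gbinom rmorphD rmorph1 /= s2x.
Qed.

(** In the Vandermonde expansion of $\binom{\delta+y}{i}$ the summand free of $\delta$ cancels, and
    [delta_val] bounds the others. *)
Lemma delta_error i j : (i < p)%N -> (j < p)%N ->
  ((sweight i j + (p * b)%N%:Z + 1)%:E <=
    v ((gbinom (y + delta) i - gbinom y i) * gbinom (x + 1) j)%R)%E.
Proof.
move=> ip jp.
have x1_val : v (gbinom (x + 1) j) = (j%:Z * - (p * b)%N%:Z)%:E.
  apply: (val_gbinom L_pchar v_norm jp); first by move: p_gt1 b_gt0; nia.
  by apply: val_addl; rewrite ?valuation1// lee_fin; move: p_gt1 b_gt0; nia.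
suff dy_val : ((- (i * m)%N%:Z + (p * b)%N%:Z + 1)%:E <=
    v (gbinom (y + delta) i - gbinom y i)%R)%E.
  apply: val_geW (val_geM v_norm dy_val (val_ge x1_val (lexx _))).
  by rewrite /sweight; lia.
rewrite [y + _]addrC (gbinom_Vandermonde L_pchar)//.
rewrite big_ord_recl gbinom0 mul1r subn0.
rewrite [X in v X]addrAC subrr add0r; apply: val_ge_sum => // -[k /= ki] _.
rewrite /bump add1n.
have iy_val := val_gbinom L_pchar v_norm
  (leq_ltn_trans (leq_subr k.+1 i) ip) _ y_val.
apply: val_geW (val_geM v_norm (delta_val _) (val_ge (iy_val _) (lexx _))).
- by nia.
- by rewrite /= (leq_ltn_trans ki).
- by move: m_gt0; lia.
Qed.

Lemma Psi1_sbasisS i j : (i < p)%N -> (j.+1 < p)%N ->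
  exists2 r, galgebra_act Psi1 (sbasis i j.+1) = sbasis i j + r &
    ((sweight i j + 1)%:E <= v r)%E.
Proof.
move=> ip jp; rewrite Psi1_act//.
exists ((gbinom (y + delta) i - gbinom y i) * gbinom (x + 1) j.+1).
  rewrite /sbasis [in LHS](gbinom_Pascal L_pchar)//.
  by rewrite (gbinom_Pascal L_pchar)//; ring.
by apply: val_geW (delta_error ip jp); rewrite /sweight; nia.
Qed.

(** Lowering $j$ by one raises the valuation by exactly $pb$; for $j=0$ only the error caused by
    $\delta$ is left. *)
Lemma Psi1_raises : raises v (galgebra_act Psi1) (p * b)%N%:Z.
Proof.
apply: (raises_basis v0_norm v_norm v_ram se_val sw_inj cardI).
move=> [[i ip] [[|j] jp]]; rewrite /se /sw /=.
  rewrite Psi1_act// /sbasis !gbinom0 !mulr1.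
  have := delta_error ip jp; rewrite gbinom0 mulr1; apply: val_geW.
  by rewrite lerDl.
have [r -> r_val] := Psi1_sbasisS ip jp.
apply: val_geD => //.
  apply: val_ge (sbasis_val ip (ltnW jp)) _.
  by rewrite /sweight; nia.
by apply: val_geW r_val; rewrite /sweight; nia.
Qed.

Lemma Psi2_sbasisS i j : (i.+1 < p)%N ->
  galgebra_act Psi2 (sbasis i.+1 j) = sbasis i j.
Proof. by apply: gbinom_difference; rewrite // gal_gbinom s2x. Qed.

Lemma Psi2_sbasis0 j : galgebra_act Psi2 (sbasis 0 j) = 0.
Proof. by apply: gbinom0_difference; rewrite gal_gbinom s2x. Qed.

Lemma Psi2_raises : raises v (galgebra_act Psi2) m%:Z.
Proof.
apply: (raises_basis v0_norm v_norm v_ram se_val sw_inj cardI).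
move=> [[[|i] ip] [j jp]]; rewrite /se /sw /=.
  by rewrite Psi2_sbasis0; apply: val_ge0.
rewrite Psi2_sbasisS//; apply: val_ge (sbasis_val (ltnW ip) jp) _.
by rewrite /sweight; nia.
Qed.

Lemma raises_iter (P : galgebra F (gal_of {:L})) s k :
  raises v (galgebra_act P) s -> raises v (galgebra_act (P ^+ k)) (k%:Z * s).
Proof.
move=> Ps z n nz; rewrite galgebra_actX; elim: k => [|k IHk] /=.
  by rewrite mul0r addr0.
by apply: val_geW (Ps _ _ IHk); rewrite intS; lia.
Qed.

(** Each application moves the main term by exactly $pb$ and the accumulated remainder by at least
    as much, so the remainder stays strictly above. *)
Lemma Psi1_iter_top i j : (i < p)%N -> (j < p)%N ->
  v (galgebra_act (Psi1 ^+ j) (sbasis i p.-1)) = (sweight i (p.-1 - j))%:E.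
Proof.
move=> ip jp; suff [r -> r_val] : exists2 r,
    galgebra_act (Psi1 ^+ j) (sbasis i p.-1) = sbasis i (p.-1 - j) + r &
    ((sweight i (p.-1 - j) + 1)%:E <= v r)%E.
  by apply: val_addl => //; apply: sbasis_val => //; lia.
elim: j jp => [|j IHj] jp.
  by exists 0; rewrite ?galgebra_actX ?subn0 ?addr0//; apply: val_ge0.
have [r rE r_val] := IHj (ltnW jp).
rewrite galgebra_actX /= -galgebra_actX rE linearD /=.
have jE : (p.-1 - j = (p.-1 - j.+1).+1)%N by lia.
rewrite [X in galgebra_act _ (sbasis i X)]jE.
have [|r' -> r'_val] := @Psi1_sbasisS i (p.-1 - j.+1) ip; first by lia.
exists (r' + galgebra_act Psi1 r); first by rewrite addrA.
apply: val_geD => //; apply: val_geW (Psi1_raises r_val).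
by rewrite jE /sweight; nia.
Qed.

Lemma Psi_product_val (alpha : L) (i j : nat) (n : int) :
  (i < p)%N -> (j < p)%N -> v alpha = n%:E -> (n = m%:Z %[mod (p ^ 2)%N%:Z])%Z ->
  v (galgebra_act (Psi2 ^+ i * Psi1 ^+ j) alpha) =
    (n + (i * m + j * p * b)%N%:Z)%:E.
Proof.
move=> ip jp an nm.
have Pp : (p.-1 < p)%N by rewrite prednK// ltnW.
pose top := (Ordinal Pp, Ordinal Pp).
apply: (val_raises v0_norm v_norm v_ram se_val sw_inj cardI (i := top)) => //.
- move=> z k kz; rewrite /= galgebra_actM.
  have := raises_iter j Psi1_raises (raises_iter i Psi2_raises kz).
  by apply: val_geW; lia.
- rewrite /= galgebra_actM /se /sw /= iter_gbinom_difference//; last first.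
    by rewrite gal_gbinom s2x.
  have -> : (i < p.-1.+1)%N by lia.
  rewrite -/(sbasis _ _) Psi1_iter_top//; last by lia.
  have top_sub k c : (k < p)%N -> (p.-1 * c = (p.-1 - k) * c + k * c)%N.
    by move=> kp; rewrite -mulnDl subnK//; lia.
  by congr EFin; rewrite /sweight (top_sub i m)// (top_sub j (p * b)%N)//; lia.
- rewrite nm /sw /= /sweight; have [k mE] := m_congr.
  (* The top weight is congruent to $m$: the difference $m+(p-1)(m+pb)$ equals $p(m-b)+p^2b$, and
     $m-b=p^2k$. *)
  apply/eqP; rewrite eqz_mod_dvd; apply/dvdzP; exists (b%:Z + p%:Z * k%:Z).
  rewrite mE expnS expn1; move: (p.-1) (prednK (ltnW p_gt1)) => q <-.
  by lia.
Qed.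

(** One more than [Psi2_raises] gives: a term of valuation exactly 0 has $p\mid im$, hence $i=0$,
    and is killed. With [Psi2_uniformizer] this places [s2] in the $m$-th lower ramification group
    but not in the next. *)
Lemma Psi2_integral z : (0%:E <= v z)%E ->
  ((m%:Z + 1)%:E <= v (s2 z - z))%E.
Proof.
move=> z0; rewrite -gbasis_sub1_act.
have [a -> az] := basis_expand_ge v0_norm v_norm v_ram se_val sw_inj cardI z0.
rewrite linear_sum; apply: val_ge_sum => // -[[[|i] ip] [j jp]] _.
  by rewrite linearZ /= /se Psi2_sbasis0 scaler0; apply: val_ge0.
rewrite [m%:Z + 1]addrC; apply: Psi2_raises; rewrite -[1]add0r.
apply: val_ge_next => // az0.
have := val_scale_congr v0_norm v_norm v_ram (se_val _) az0.
move/sweight_mod_p; rewrite add0r dvdzE /= Euclid_dvdM//.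
by rewrite (negPf m_ndvd) orbF gtnNdvd.
Qed.

(** As $p\nmid 1$, the leading term has $i>0$, and $\Psi_2$ shifts it by exactly $m$. *)
Lemma Psi2_uniformizer z : v z = 1%:E -> v (s2 z - z) = (m%:Z + 1)%:E.
Proof.
move=> z1; rewrite -gbasis_sub1_act [m%:Z + 1]addrC.
have [[[i ip] [j jp]] [a [r [zE az rz]]]] :=
  basis_leading_term v0_norm v_norm v_ram se_val sw_inj cardI z1.
rewrite {}zE linearD /=; apply: val_addl => //; last first.
  by apply: val_geW (Psi2_raises rz); rewrite addrAC.
have az1 := val_scale_congr v0_norm v_norm v_ram (se_val _) az.
have {az1} az1 : (1 = sweight i j %[mod (p ^ 2)%N%:Z])%Z by [].
case: i ip az az1 => [|i] ip az az1.
  move/sweight_mod_p: az1; rewrite mul0n addr0 dvdzE /= dvdn1.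
  by rewrite gtn_eqF.
have [k ak] : exists k, v0 a = k%:E.
  apply: val_fin => //; apply/eqP => a0.
  by rewrite a0 scale0r valuation0 in az.
rewrite linearZ /= /se Psi2_sbasisS//.
rewrite (val_scale v_norm v_ram ak (sbasis_val (ltnW ip) jp)).
move: az; rewrite (val_scale v_norm v_ram ak (se_val _)) => -[azE].
by congr EFin; rewrite -azE /sw /sweight /=; nia.
Qed.

End Scaffold.

(** * Membership in the augmentation ideal *)

Section AugmentationIdeal.
Variables (R : nzRingType) (gT : finGroupType).
Implicit Types a b : galgebra R gT.

Lemma augmentation_idealD a b : augmentation_ideal a -> augmentation_ideal b ->
  augmentation_ideal (a + b).
Proof.
move=> [c ->] [d ->]; exists (fun g => c g + d g).
by rewrite -big_split; apply: eq_bigr => g _; rewrite mulrDl.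
Qed.

Lemma augmentation_idealM a b : augmentation_ideal b ->
  augmentation_ideal (a * b).
Proof.
move=> [d ->]; exists (fun g => a * d g).
by rewrite mulr_sumr; apply: eq_bigr => g _; rewrite mulrA.
Qed.

Lemma augmentation_ideal_basis (g : gT) : augmentation_ideal (gbasis R g - 1).
Proof.
exists (fun h => if h == g then 1 else 0).
rewrite (bigD1 g)//= eqxx mul1r big1 ?addr0// => h /negPf->.
by rewrite mul0r.
Qed.

End AugmentationIdeal.

Lemma galgebra_scaleAl (F : fieldType) (gT : finGroupType) (c : F)
    (a b : galgebra F gT) : c *: (a * b) = (c *: a) * b.
Proof.
apply/ffunP => g; rewrite !ffunE scaler_sumr; apply: eq_bigr => h _.
by rewrite ffunE /GRing.scale /= mulrA.
Qed.

(** The degree-zero term of the truncated power contributes $\sigma_1-1$; every other term is a left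
    multiple of $\sigma_2-1$. *)
Lemma augmentation_ideal_Psi1 (F : fieldType) (gT : finGroupType) p (mu : F)
  (s1 s2 : gT) : (0 < p)%N ->
  augmentation_ideal (gbasis F s1 * truncated_power p mu s2 - 1).
Proof.
case: p => // p _; rewrite /truncated_power big_ord_recl expr0 gbinom0 scale1r.
rewrite mulrDr mulr1 addrAC; apply: augmentation_idealD.
  exact: augmentation_ideal_basis.
rewrite mulr_sumr; elim/big_ind: _ => [||i _].
- exists (fun=> 0); rewrite big1// => g _; exact: mul0r.
- exact: augmentation_idealD.
- rewrite exprSr galgebra_scaleAl; do 2!apply: augmentation_idealM.
  exact: augmentation_ideal_basis.
Qed.

(** * From the valuation formula to a Galois scaffold *)

Section ScaffoldOfValuations.
Variables (F : fieldType) (L : splittingFieldType F) (p b1 b2 : nat).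
Variables (v : L -> \bar int) (Psi1 Psi2 : galgebra F (gal_of {:L})).
Hypothesis p_gt1 : (1 < p)%N.
Hypothesis Psi1_aug : augmentation_ideal Psi1.
Hypothesis Psi2_aug : augmentation_ideal Psi2.
Hypothesis weight_inj : forall i j : 'I_p * 'I_p,
  (sweight p b1 b2 i.1 i.2 = sweight p b1 b2 j.1 j.2 %[mod (p ^ 2)%N%:Z])%Z ->
  i = j.
Hypothesis Psi_val : forall (alpha : L) (i j : nat) (n : int),
  (i < p)%N -> (j < p)%N ->
  v alpha = n%:E -> (n = b2%:Z %[mod (p ^ 2)%N%:Z])%Z ->
  v (galgebra_act (Psi2 ^+ i * Psi1 ^+ j) alpha) =
    (n + (i * b2 + j * p * b1)%N%:Z)%:E.

(** Pigeonhole: the $p^2$ index pairs have distinct residues, so they fill all $p^2$ classes. *)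
Lemma shifted_weights_complete (n r : int) : exists i : 'I_p * 'I_p,
  (n + (i.1 * b2 + i.2 * p * b1)%N%:Z = r %[mod (p ^ 2)%N%:Z])%Z.
Proof.
have q_gt0 : (0 < p ^ 2)%N by rewrite expn_gt0 ltnW.
have q_neq0 : (p ^ 2)%N%:Z != 0 by rewrite eqz_nat -lt0n.
pose f (i : 'I_p * 'I_p) : int := n - sweight p b1 b2 i.1 i.2.
have f_lt (k : int) : (`|(k %% (p ^ 2)%N%:Z)%Z|%N < p ^ 2)%N.
  by rewrite -ltz_nat gez0_abs ?modz_ge0// ltz_pmod.
pose g i := Ordinal (f_lt (f i)).
have modz_absE (k l : int) :
    `|(k %% (p ^ 2)%N%:Z)%Z|%N = `|(l %% (p ^ 2)%N%:Z)%Z|%N ->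
    (k = l %[mod (p ^ 2)%N%:Z])%Z.
  by move=> /(congr1 Posz); rewrite !gez0_abs ?modz_ge0.
have g_inj : injective g.
  move=> i j [/modz_absE/eqP]; rewrite eqz_mod_dvd /f opprB addrC addrA subrK.
  by rewrite -eqz_mod_dvd => /eqP/esym/weight_inj.
have /codomP[i ri] : Ordinal (f_lt r) \in codom g.
  by apply: inj_card_onto => //; rewrite card_prod !card_ord expnS expn1.
exists i; rewrite -(modz_absE (f i) r); last by case: ri.
by congr modz; rewrite /f /sweight; lia.
Qed.

Lemma galois_scaffold_of_valuations : galois_scaffold p v b2 Psi1 Psi2.
Proof.
have p_gt0 : (0 < p)%N by apply: ltnW.
(* Each operator has a constant shift [c], namely $pb_1$ or $b_2$, and its $j$-th power shifts by
   $jc$; this is condition (i) of a scaffold. *)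
have PsiX_val Psi : Psi = Psi1 \/ Psi = Psi2 -> exists c : nat,
    forall (j : nat) (rho : L) n, (j < p)%N ->
    v rho = n%:E -> (n = b2%:Z %[mod (p ^ 2)%N%:Z])%Z ->
    v (galgebra_act (Psi ^+ j) rho) = (n + (j * c)%N%:Z)%:E.
  case=> ->; [exists (p * b1)%N|exists b2] => j rho n jp rn nb.
    have := Psi_val p_gt0 jp rn nb; rewrite expr0 mul1r => ->.
    by congr EFin; lia.
  have := Psi_val jp p_gt0 rn nb; rewrite expr0 mulr1 => ->.
  by congr EFin; lia.
split=> // [Psi /PsiX_val[c Pc] j rho rho' jp|rho [n rn nb]].
  move=> [n rn nb] [n' rn' nb'].
  rewrite (Pc _ _ _ jp rn nb) -[Psi in X in _ = X]expr1.
  rewrite (Pc _ _ _ p_gt1 rn' nb') rn rn' -!EFinB -EFinM.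
  by congr EFin; lia.
split=> [y [[i j] _ <-]|r].
  by rewrite (Psi_val (ltn_ord i) (ltn_ord j) rn nb).
have [i ir] := shifted_weights_complete n r.
exists (n + (i.1 * b2 + i.2 * p * b1)%N%:Z); split.
  split=> //; exists i => //; exact: Psi_val.
move=> k [[j _]].
rewrite (Psi_val (ltn_ord j.1) (ltn_ord j.2) rn nb) => -[<-] jr.
suff -> : i = j by [].
apply: weight_inj; have := etrans ir (esym jr) => /eqP.
rewrite eqz_mod_dvd => d; apply/eqP; rewrite eqz_mod_dvd -rpredN.
have -> : - (sweight p b1 b2 i.1 i.2 - sweight p b1 b2 j.1 j.2) =
    n + (i.1 * b2 + i.2 * p * b1)%N%:Z - (n + (j.1 * b2 + j.2 * p * b1)%N%:Z).
  by rewrite /sweight; lia.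
exact: d.
Qed.

End ScaffoldOfValuations.

(** * The map $\wp$ in characteristic $p$ *)

Lemma wp_prod (F : fieldType) p (x : F) : p \in [pchar F] ->
  wp p x = \prod_(n < p) (x + n%:R).
Proof.
move=> pF; have p_prime : prime p by case/andP: pF.
(* The negatives of $0,\dots,p-1$ are $p$ distinct roots of the monic polynomial $X^p-X$, which
   therefore factors over them. *)
pose rs : seq F := [seq - n%:R | n <- iota 0 p].
have X_lt : (size (- 'X : {poly F}) < size ('X^p : {poly F}))%N.
  by rewrite size_polyN size_polyX size_polyXn ltnS prime_gt1.
have rs_root : all (root ('X^p - 'X)) rs.
  apply/allP => _ /mapP[n _ ->]; rewrite rootE !hornerE.
  by rewrite -[_ ^+ p]/(pFrobenius_aut pF _) rmorphN rmorph_nat subrr.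
have rs_uniq : uniq_roots rs.
  rewrite uniq_rootsE map_inj_in_uniq ?iota_uniq// => i j.
  rewrite !mem_iota !add0n /= => ip jp /oppr_inj.
  wlog ij : i j ip jp / (i <= j)%N => [W|].
    have [|ji] := leqP i j; first exact: W.
    by move=> ijE; apply/esym/W => //; apply: ltnW.
  move=> /esym/eqP; rewrite -subr_eq0 -natrB// -(dvdn_pcharf pF) => d.
  have [ji|] := posnP (j - i)%N; first by lia.
  by move=> /dvdn_leq/(_ d); lia.
have := all_roots_prod_XsubC _ rs_root rs_uniq.
rewrite size_polyDl// size_polyXn size_map size_iota lead_coefDl//.
rewrite lead_coefXn scale1r => /(_ erefl)/(congr1 (horner^~ x)).
rewrite !hornerE horner_prod big_map /wp => ->.
rewrite -[iota 0 p](congr1 (iota 0) (subn0 p)) big_mkord.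
by apply: eq_bigr => i _; rewrite !hornerE opprK.
Qed.

Lemma wpB (F : fieldType) p (x y : F) : p \in [pchar F] ->
  wp p (x - y) = wp p x - wp p y.
Proof.
move=> pF; rewrite /wp -![_ ^+ p]/(pFrobenius_aut pF _) rmorphB /=.
by move: (pFrobenius_aut pF x) (pFrobenius_aut pF y) => fx fy; ring.
Qed.

Lemma laurent_pchar (K : fieldType) p :
  p \in [pchar K] -> p \in [pchar (laurent K)].
Proof.
move=> pK; have p_prime : prime p by case/andP: pK.
rewrite inE p_prime /=; apply/eqP/laurentP => n.
have coefMn (x : laurent K) k : lcoef (x *+ k) n = lcoef x n *+ k.
  by elim: k => [|k IHk]; rewrite ?mulr0n// !mulrS -IHk.
by rewrite coefMn mulrn_pchar.
Qed.

(** * Determination of a lower ramification number *)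

Section LowerBreak.
Variables (F : fieldType) (L : splittingFieldType F) (p : nat).
Implicit Types (s : gal_of {:L}) (U : {subfield L}).

Lemma gal_Fadjoin_fix s x : s x = x -> s \in 'Gal({:L} / <<1; x>>)%g.
Proof.
move=> sx; rewrite -finset.sub1set galois_connection ?subvf//.
apply/FadjoinP; split; first exact: sub1v.
by apply/fixedFieldP; rewrite ?memvf// => t /set1P->.
Qed.

(** The order divides $p^2$, and order $p^2$ would put [s] among the automorphisms fixing [x]. *)
Lemma card_gal_Fadjoin s x : prime p -> galois 1 {:L} ->
  \dim {:L} = (p ^ 2)%N -> s x != x -> (#|'Gal({:L} / <<1; x>>)%g| <= p)%N.
Proof.
move=> p_prime galL dimL sx.
have GE : #|'Gal({:L} / 1)%g| = (p ^ 2)%N.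
  by rewrite -galois_dim// dimL dimv1 divn1.
have sub : 'Gal({:L} / <<1; x>>)%g \subset 'Gal({:L} / 1)%g.
  by apply: galS; apply: sub1v.
have := cardSg sub; rewrite GE => /(dvdn_pfactor _ _ p_prime)[[|[|[|//]]] _ e].
- by rewrite e prime_gt0.
- by rewrite e expn1.
have : s \in 'Gal({:L} / <<1; x>>)%g.
  have /eqP -> : 'Gal({:L} / <<1; x>>)%g == 'Gal({:L} / 1)%g.
    by rewrite eqEcard sub GE e leqnn.
  rewrite -finset.sub1set galois_connection ?subvf//; exact: sub1v.
move=> /fixed_gal -/(_ x (subvf _) (memv_adjoin _ _)) sxx.
by rewrite sxx eqxx in sx.
Qed.

(** The bounds put [s] in the $i$-th ramification group exactly for $i\le m$. The group has order at
    most $p$, so the drop by a factor $p$ at [b] goes from the whole group to the trivial one;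
    comparison gives $b=m$. *)
Lemma lower_break_eq (v : L -> \bar int) U (b m : nat) s z :
  (1 < p)%N -> (forall n : int, (n%:E <= v 0%R)%E) ->
  lower_ramification_numbers p v U {:L}%AS [:: b] ->
  (#|'Gal({:L} / U)%g| <= p)%N -> s \in 'Gal({:L} / U)%g ->
  (forall y, (0%:E <= v y)%E -> ((m%:Z + 1)%:E <= v (s y - y)%R)%E) ->
  (0%:E <= v z)%E -> v (s z - z) = (m%:Z + 1)%:E -> b = m.
Proof.
move=> p1 v0 [_ ram] cardG sG s_ge z0 sz.
have memG i : s \in ramification_group v U {:L}%AS i = (i <= m)%N.
  rewrite inE sG; apply/asboolP/idP => [/(_ z (memvf _) z0)|im y _ y0].
    by rewrite sz lee_fin; lia.
  by apply: le_trans (s_ge y y0); rewrite lee_fin; lia.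
have Gsub i : ramification_group v U {:L}%AS i \subset 'Gal({:L} / U)%g.
  by apply/fintype.subsetP => t; rewrite inE => /andP[].
have G1 i : 1%g \in ramification_group v U {:L}%AS i.
  by rewrite inE group1; apply/asboolP => y _ _; rewrite gal_id subrr.
have := ram b; rewrite /= eqxx addn0 expn1 => Gb.
have Gb1_gt0 : (0 < #|ramification_group v U {:L}%AS b.+1|)%N.
  by apply/card_gt0P; exists 1%g.
have Gb_le := leq_trans (subset_leq_card (Gsub b)) cardG.
have Gb1 : #|ramification_group v U {:L}%AS b.+1| = 1%N.
  apply/eqP; rewrite eqn_leq Gb1_gt0 andbT.
  by move: Gb_le; rewrite Gb -[X in (_ <= X)%N]muln1 leq_pmul2l// ltnW.
have GbE : ramification_group v U {:L}%AS b = 'Gal({:L} / U)%g.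
  by apply/eqP; rewrite eqEcard Gsub Gb Gb1 muln1.
apply/eqP; rewrite eqn_leq -memG GbE sG /= leqNgt -memG; apply/negP => sGb1.
move/eqP/cards1P: Gb1 => [t Gt]; have := G1 b.+1; rewrite Gt => /set1P t1.
move: sGb1; rewrite Gt -t1 => /set1P s1.
(* If [s] were trivial, the difference would be 0, of valuation $m+1$ and yet at least $m+2$. *)
move: sz (v0 (m%:Z + 2)); rewrite s1 gal_id subrr => ->.
by rewrite lee_fin; lia.
Qed.

End LowerBreak.

(** * Galois action on and valuations of Artin-Schreier generators *)

Lemma gal_expg_add1 (F : fieldType) (L : splittingFieldType F)
    (s : gal_of {:L}) (x : L) k : s x = x + 1 -> (s ^+ k)%g x = x + k%:R.
Proof.
move=> sx; elim: k => [|k IHk]; first by rewrite expg0 gal_id addr0.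
by rewrite expgS galM ?memvf// sx rmorphD rmorph1 /= IHk -addrA natr1.
Qed.

(** Every shift must have valuation [n], not [x] alone, since at $n=0$ the terms $x^p$ and $x$ may
    cancel; the product formula for $\wp$ then gives the value. *)
Lemma val_wp_shifts (F : fieldType) p (v : F -> \bar int) x (n : int) :
  p \in [pchar F] -> normalized_valuation predT v ->
  (forall i, (i < p)%N -> v (x + i%:R) = n%:E) ->
  v (wp p x) = (p%:Z * n)%:E.
Proof.
move=> pF v_norm xn; rewrite wp_prod//.
suff prod_val k : (k <= p)%N ->
  v (\prod_(i < k) (x + i%:R)) = (k%:Z * n)%:E by apply: prod_val.
elim: k => [|k IHk] kp; first by rewrite big_ord0 valuation1// mul0r.
rewrite big_ord_recr (val_mul v_norm (IHk (ltnW kp)) (xn _ kp)).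
by rewrite intS mulrDl mul1r addrC.
Qed.

Lemma val_Artin_Schreier (F : fieldType) (L : fieldExtType F) (p b : nat)
    (v0 : F -> \bar int) (v : L -> \bar int) (beta : F) (x : L) :
  normalized_valuation predT v ->
  (forall a : F, v a%:A = ((p ^ 2)%:Z%:E * v0 a)%E) ->
  (1 < p)%N -> (0 < b)%N -> v0 beta = (- b%:Z)%:E -> wp p x = beta%:A ->
  v x = (- (p * b)%N%:Z)%:E.
Proof.
move=> v_norm v_ram p1 b0 beta_val wp_x; apply: (val_wp v_norm p1).
  by nia.
by rewrite wp_x (val_alg v_ram beta_val) expnS expn1; congr EFin; lia.
Qed.

(** * The common setting of both group types *)

Section Core.
Variables (F : fieldType) (L : splittingFieldType F) (p : nat).
Variables (v0 : F -> \bar int) (v : L -> \bar int).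
Hypothesis F_pchar : p \in [pchar F].
Hypothesis v0_norm : normalized_valuation predT v0.
Hypothesis v_norm : normalized_valuation predT v.
Hypothesis v_ram : forall a : F, v a%:A = ((p ^ 2)%:Z%:E * v0 a)%E.
Hypothesis dimL : \dim {:L} = (p ^ 2)%N.
Hypothesis galL : galois 1 {:L}.

Variables (b k : nat) (beta1 beta2 mu : F) (x1 x2 err : L).
Variables s1 s2 : gal_of {:L}.
Let m := (b + p ^ 2 * k)%N.
Hypothesis b_ndvd : ~~ (p %| b)%N.
Hypothesis beta1_val : v0 beta1 = (- b%:Z)%:E.
Hypothesis wp_x1 : wp p x1 = beta1%:A.
(** [err] stands for 0 in the elementary abelian case and for [D1] in the cyclic case. *)
Hypothesis wp_x2 : wp p x2 = err + beta2%:A.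
(** For $k=0$ this excludes that $\mu$ reduces into the prime field, so $\wp(\mu)$ has valuation
    $-pk$ in every case. *)
Hypothesis mu_val : forall n, (n < p)%N -> v0 (mu + n%:R) = (- k%:Z)%:E.
Hypothesis eps_val :
  ((1 - (p * m)%N%:Z)%:E <= v (beta2 - mu ^+ p * beta1)%R%:A%R)%E.
Hypothesis err_val : ((1 - (p * m)%N%:Z)%:E <= v err)%E.
Hypothesis s1x1 : s1 x1 = x1 + 1.
Hypothesis s2x1 : s2 x1 = x1.
Hypothesis s2x2 : s2 x2 = x2 + 1.
Hypothesis s2delta : s2 (s1 x2 - x2) = s1 x2 - x2.
Hypothesis delta_val : forall i, (0 < i < p)%N ->
  (((p * b)%N%:Z + 1 - (i * m)%N%:Z)%:E <= v (gbinom (s1 x2 - x2) i))%E.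

Let p_prime : prime p. Proof. by case/andP: F_pchar. Qed.
Let p_gt1 : (1 < p)%N. Proof. exact: prime_gt1. Qed.
Let L_pchar : p \in [pchar L]. Proof. by rewrite pchar_lalg. Qed.
Let b_gt0 : (0 < b)%N.
Proof. by rewrite lt0n; apply: contraNneq b_ndvd => ->. Qed.

Let y := x2 - mu%:A * x1.

Let x1_val : v x1 = (- (p * b)%N%:Z)%:E.
Proof. exact: (val_Artin_Schreier v_norm v_ram p_gt1 b_gt0 beta1_val). Qed.

Let y_val : v y = (- m%:Z)%:E.
Proof.
apply: (val_wp v_norm p_gt1); first by rewrite /m; move: b_gt0; nia.
(* The part $\mu^p\beta_1$ of $\beta_2$ cancels and leaves $-(\mu^p-\mu)x_1$, of valuation
   $-p(p^2k+b)=-pm$; [err] and $\varepsilon$ lie above it. *)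
have -> : wp p y = - ((wp p mu)%:A * x1) +
    (err + (beta2 - mu ^+ p * beta1)%:A).
  rewrite wpB// wp_x2; have -> : wp p (mu%:A * x1) =
      (mu ^+ p)%:A * (x1 + beta1%:A) - mu%:A * x1 :> L.
    rewrite -wp_x1 /wp exprMn -!(in_algE L) rmorphXn /=.
    by ring.
  rewrite -!(in_algE L) /wp !(rmorphB, rmorphM, rmorphXn) /=; ring.
apply: val_addl => //.
  have wp_mu_val := val_wp_shifts F_pchar v0_norm mu_val.
  rewrite valuationN// (val_mul v_norm (val_alg v_ram wp_mu_val) x1_val).
  by congr EFin; rewrite /m; lia.
by apply: val_geD => //; [apply: val_geW err_val|apply: val_geW eps_val]; lia.
Qed.

Let s1y : s1 y = y - mu%:A + (s1 x2 - x2).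
Proof. by rewrite /y rmorphB rmorphM /= rmorph_alg s1x1; ring. Qed.

Let s2y : s2 y = y + 1.
Proof. by rewrite /y rmorphB rmorphM /= rmorph_alg s2x1 s2x2; ring. Qed.

Let m_congr : exists k, m = (b + p ^ 2 * k)%N. Proof. by exists k. Qed.

Lemma Artin_Schreier_scaffold (b2 : nat) :
  lower_ramification_numbers p v <<1; x1>>%AS {:L}%AS [:: b2] ->
  let Psi1 := gbasis F s1 * truncated_power p mu s2 - 1 in
  let Psi2 := gbasis F s2 - 1 in
  galois_scaffold p v b2 Psi1 Psi2 /\
  forall (alpha : L) (i j : nat),
    val_congr v (p ^ 2) b2 alpha -> (i <= p - 1)%N -> (j <= p - 1)%N ->
    v (galgebra_act (Psi2 ^+ i * Psi1 ^+ j) alpha) =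
      (v alpha + (i * b2 + j * p * b)%N%:Z%:E)%E.
Proof.
move=> breaks Psi1 Psi2; have b2E : b2 = m.
  (* A uniformizer attains the bound that defines the ramification number. *)
  have [_ _ _ /(_ 1)[z _ z1]] := v_norm.
  apply: (@lower_break_eq _ _ p v <<1; x1>>%AS _ _ s2 z) => //.
  - by move=> n; apply: val_ge0.
  - apply: (@card_gal_Fadjoin _ _ _ s1) => //.
    by rewrite s1x1 -subr_eq0 addrC addKr oner_neq0.
  - exact: gal_Fadjoin_fix.
  - move=> w; apply: (Psi2_integral F_pchar v0_norm v_norm v_ram dimL
      b_ndvd m_congr x1_val y_val s2x1 s2y).
  - by rewrite z1 lee_fin.
  - exact: (Psi2_uniformizer F_pchar v0_norm v_norm v_ram dimL
      b_ndvd m_congr x1_val y_val s2x1 s2y).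
rewrite {breaks}b2E.
have Psi_val := Psi_product_val F_pchar v0_norm v_norm v_ram dimL b_ndvd
  m_congr x1_val y_val s1x1 s2x1 s1y s2y s2delta delta_val.
split=> [|alpha i j [n an nm] ip jp].
  apply: (@galois_scaffold_of_valuations _ _ p b) => //.
  - by apply: augmentation_ideal_Psi1; apply: ltnW.
  - exact: augmentation_ideal_basis.
  - apply: sweight_inj => //; exact: (m_ndvd b_ndvd m_congr).
by rewrite (Psi_val _ _ _ _ _ _ an)// ?an//; lia.
Qed.

End Core.

(** * The Witt vector correction term of the cyclic case *)

Lemma val_ge_exp_diff (F : fieldType) (v : F -> \bar int) (x : F) (n : int) i :
  normalized_valuation predT v -> n <= 0 -> (n%:E <= v x)%E ->
  ((i%:Z * n)%:E <= v ((x + 1) ^+ i.+1 - x ^+ i.+1)%R)%E.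
Proof.
move=> v_norm n0 nx; have nx1 : (n%:E <= v (x + 1)%R)%E.
  by apply: val_geD => //; rewrite valuation1.
elim: i => [|i IHi].
  by rewrite !expr1 addrC addKr valuation1// mul0r.
(* The difference of $n$-th powers has degree $n-1$ in $x$; peeling off one factor $x+1$ gives the
   recursion. *)
have -> : (x + 1) ^+ i.+2 - x ^+ i.+2 =
    (x + 1) * ((x + 1) ^+ i.+1 - x ^+ i.+1) + x ^+ i.+1.
  by rewrite !(exprS _ i.+1); ring.
apply: val_geD => //; last exact: val_geX.
by apply: val_geW (val_geM v_norm nx1 IHi); rewrite intS; lia.
Qed.

Section WittCorrection.
Variables (K : fieldType) (p : nat) (L : splittingFieldType (laurent K)).
Variables (v : L -> \bar int) (b : nat) (beta1 : laurent K) (x1 : L).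
Hypothesis v_norm : normalized_valuation predT v.
Hypothesis p_gt1 : (1 < p)%N.
Hypothesis beta1_val : v beta1%:A = (- (p ^ 2 * b)%N%:Z)%:E.
Hypothesis x1_val : v x1 = (- (p * b)%N%:Z)%:E.

(** The worst term is $i=1$, since replacing a factor $\beta_1$ by $x_1$ raises the valuation from
    $-p^2b$ to $-pb$. *)
Lemma val_ge_D1 :
  ((- (p * b + (p - 1) * (p ^ 2 * b))%N%:Z)%:E <= v (D1 p beta1 x1))%E.
Proof.
rewrite valuationN// big_nat; apply: val_ge_sum => // i /andP[i0 ip].
apply: val_ge_mulrn => //.
have xi := val_exp v_norm i x1_val.
apply: val_ge (val_mul v_norm xi (val_exp v_norm (p - i) beta1_val)) _.
have -> : (p - 1 = (p - i) + (i - 1))%N by lia.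
have [j ->] : exists j, i = j.+1 by exists i.-1; lia.
by rewrite expnS expn1 subn1 /=; nia.
Qed.

(** The difference $(x_1+1)^i-x_1^i$ saves a factor $x_1$, so the worst term $i=1$ costs only
    $\beta_1^{p-1}$. The bound is written as a multiple of $p$ so that it passes through $\wp$ to
    $\sigma_1x_2-x_2$. *)
Lemma val_ge_D1_shift (s : gal_of {:L}) : s x1 = x1 + 1 ->
  ((p%:Z * - ((p - 1) * (p * b))%N%:Z)%:E <=
    v (s (D1 p beta1 x1) - D1 p beta1 x1))%E.
Proof.
move=> sx1; rewrite /D1 rmorphN rmorph_sum /= -opprD valuationN// -sumrB.
rewrite big_nat; apply: val_ge_sum => // i /andP[i0 ip].
have sE : s (x1 ^+ i * beta1%:A ^+ (p - i)) =
    (x1 + 1) ^+ i * beta1%:A ^+ (p - i).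
  by rewrite rmorphM !rmorphXn /= rmorph_alg sx1.
rewrite rmorphMn /= sE -mulrnBl -mulrBl.
apply: val_ge_mulrn => //.
have [j iE] : exists j, i = j.+1 by exists i.-1; lia.
have w0 : - (p * b)%N%:Z <= 0 :> int by lia.
have xi : ((- (p * b)%N%:Z)%:E <= v x1)%E by rewrite x1_val.
have := val_geM v_norm (val_ge_exp_diff j v_norm w0 xi)
  (val_ge (val_exp v_norm (p - i) beta1_val) (lexx _)).
rewrite -iE; apply: val_geW.
have -> : (p - 1 = (p - i) + j)%N by lia.
by rewrite expnS expn1; nia.
Qed.

End WittCorrection.

(** * The valuation of $\mu$, from the bound on $\varepsilon$ *)

Lemma ratbar_bound (a n : int) (p c : nat) (y : \bar int) : (0 < p)%N ->
  (to_ratbar a%:E + (c%:R / p%:R : rat)%:E < to_ratbar y)%E -> y = n%:E ->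
  p%:Z * a + c%:Z < p%:Z * n.
Proof.
move=> p0 + yn; rewrite yn /to_ratbar /= -EFinD lte_fin => lt_y.
have p0' : 0 < p%:R :> rat by rewrite ltr0n.
rewrite -(ltr_int rat) rmorphD !rmorphM /= -!pmulrn.
rewrite [ltRHS]mulrC -ltr_pdivrMr// mulrDl [p%:R * _]mulrC mulfK//.
by rewrite gt_eqF.
Qed.

Section MuValuation.
Variables (K : fieldType) (p b : nat) (beta1 beta2 mu : laurent K).
Hypothesis K_pchar : p \in [pchar K].
Hypothesis beta1_val : lval beta1 = (- b%:Z)%:E.
Let eps := beta2 - mu ^+ p * beta1.
Let p_gt1 : (1 < p)%N. Proof. by apply: prime_gt1; case/andP: K_pchar. Qed.
Let v_norm := lval_normalized K.

(* If v0(mu) = 0 < v0(mu + n), then beta2 + n beta1 = (mu + n)^p beta1 + eps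
   would have larger valuation than beta2. *)
Lemma mu_shift_valuation q : lval mu = q%:E ->
  lval beta2 = (p%:Z * q - b%:Z)%:E ->
  ((p%:Z * q - b%:Z + 1)%:E <= lval eps)%E -> q <= 0 ->
  (q = 0 -> forall n, (n < p)%N ->
    (lval (beta2 + beta1 *+ n)%R <= lval beta2)%E) ->
  forall n, (n < p)%N -> lval (mu + n%:R) = q%:E.
Proof.
move=> muq b2q eps_ge q0 b2max n np.
have [q_lt0|] := ltP q 0.
  apply: val_addl => //; apply: val_geW (val_ge_nat v_norm n); lia.
move=> q_ge0; have {q_ge0 q0} q0 : q = 0 by lia.
have mun_ge : (0%:E <= lval (mu + n%:R)%R)%E.
  by apply: val_geD => //; [rewrite muq q0|apply: val_ge_nat].
apply: contrapT; rewrite q0 => /(val_ge_next v_norm mun_ge) mun1.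
have := b2max q0 n np; rewrite leNgt => /negP; apply.
have -> : beta2 + beta1 *+ n = (mu + n%:R) ^+ p * beta1 + eps.
  have K0_pchar := laurent_pchar K_pchar.
  rewrite -[(mu + _) ^+ p]/(pFrobenius_aut K0_pchar _) rmorphD rmorph_nat.
  by rewrite /= pFrobenius_autE /eps -mulr_natl; ring.
rewrite b2q q0 mulr0 add0r.
apply: (@lt_le_trans _ _ (- b%:Z + 1)%:E); first by rewrite lte_fin; lia.
apply: val_geD => //; last first.
  by move: eps_ge; rewrite q0 mulr0 add0r.
apply: val_geW (val_geM v_norm (val_geX v_norm p mun1)
  (val_ge beta1_val (lexx _))).
by move: p_gt1; lia.
Qed.

Let bound := (to_ratbar (lval beta2) +
  (((p - 1) * b)%:R / p%:R : rat)%R%:E)%E.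
Hypothesis eps_bound : (bound < to_ratbar (lval eps))%E.

(** The bound puts $\varepsilon$ above $\beta_2$, so $\mu^p\beta_1=\beta_2-\varepsilon$ has the
    valuation of $\beta_2$, which ties $v_0(\beta_2)$ to $q$. Multiplied by $p$, the bound itself
    becomes $p^2q-b$, which is $-m$. *)
Lemma mu_valuation : exists q : int,
  [/\ lval mu = q%:E, lval beta2 = (p%:Z * q - b%:Z)%:E,
      ((p%:Z * q - b%:Z + 1)%:E <= lval eps)%E &
      forall (x : laurent K) n, (bound < to_ratbar (lval x))%E ->
        lval x = n%:E -> (p ^ 2)%N%:Z * q - b%:Z < p%:Z * n].
Proof.
(* If $\beta_2$ were 0, the bound would be infinite and nothing could exceed it. *)
have [b20|/(val_fin v_norm)[n2 b2n]] := eqVneq beta2 0.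
  by move: eps_bound; rewrite /bound b20 (valuation0 v_norm) ltNge leey.
have bd (x : laurent K) n : (bound < to_ratbar (lval x))%E -> lval x = n%:E ->
    p%:Z * n2 + ((p - 1) * b)%N%:Z < p%:Z * n.
  by rewrite /bound b2n; apply: ratbar_bound; apply: ltnW.
have eps_ge : ((n2 + 1)%:E <= lval eps)%E.
  have [->|/(val_fin v_norm)[n epsn]] := eqVneq eps 0; first exact: val_ge0.
  have := bd _ _ eps_bound epsn; rewrite epsn lee_fin.
  by move: p_gt1; nia.
have mub : lval (mu ^+ p * beta1) = n2%:E.
  have -> : mu ^+ p * beta1 = beta2 + - eps by rewrite /eps; ring.
  by apply: val_addl; rewrite ?valuationN.
have mu0 : mu != 0.
  apply: contra_eq_neq mub => ->.
  by rewrite expr0n gtn_eqF ?mul0r ?(valuation0 v_norm)// ltnW.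
have [q muq] := val_fin v_norm mu0.
have n2E : n2 = p%:Z * q - b%:Z.
  have := val_mul v_norm (val_exp v_norm p muq) beta1_val.
  by rewrite mub => -[].
exists q; split; rewrite -?n2E// => x n xb xn; have := bd x n xb xn.
by rewrite n2E expnS expn1; nia.
Qed.

End MuValuation.

(** * Verification of the common hypotheses for $C_p\times C_p$ and $C_{p^2}$ *)

Theorem theorem2p1 (p : nat) (kappa : fieldType)
    (kappa_char : p \in [pchar kappa])
    (kappa_perfect : forall c : kappa, exists d : kappa, d ^+ p = c)
    (L : splittingFieldType (laurent kappa))
    (L_galois : galois 1 {:L}) (L_dim : \dim {:L} = (p ^ 2)%N)
    (b1 b2 : nat) (beta1 beta2 : laurent kappa) (x1 x2 : L)
    (sigma1 sigma2 : gal_of {:L})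
    (v1 v2 : L -> \bar int)
    (v1_normalized : normalized_valuation (mem <<1; x1>>%AS) v1)
    (v2_normalized : normalized_valuation predT v2)
    (L_ramified : forall a : laurent kappa,
       v2 a%:A = ((p ^ 2)%:Z%:E * lval a)%E)
    (L_breaks : lower_ramification_numbers p v2 1%AS {:L}%AS [:: b1; b2])
    (K1_break : lower_ramification_numbers p v1 1%AS <<1; x1>>%AS [:: b1])
    (L_K1_break : lower_ramification_numbers p v2 <<1; x1>>%AS {:L}%AS [:: b2])
    (data : elementary_abelian_data p b1 beta1 beta2 x1 x2 sigma1 sigma2 \/
            cyclic_data p b1 beta1 beta2 x1 x2 sigma1 sigma2)
    (mu_ : nat -> laurent kappa)
    (beta2E : beta2 = \sum_(t < p) mu_ t ^+ p * beta1 ^+ t)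
    (mu0_const : exists c : kappa, mu_ 0%N ^+ p = lconst c) :
  let mu := mu_ 1%N in
  let epsilon := beta2 - mu ^+ p * beta1 in
  let bound :=
    (to_ratbar (lval beta2) + (((p - 1) * b1)%:R / p%:R : rat)%R%:E)%E in
  (bound < to_ratbar (lval epsilon))%E ->
  ('Gal({:L} / 1)%g \isog [set: 'Z_(p ^ 2)] ->
     (bound < to_ratbar (lval (beta1 ^+ p)%R))%E) ->
  let Psi1 : galgebra (laurent kappa) (gal_of {:L}) :=
    gbasis (laurent kappa) sigma1 * truncated_power p mu sigma2 - 1 in
  let Psi2 : galgebra (laurent kappa) (gal_of {:L}) :=
    gbasis (laurent kappa) sigma2 - 1 in
  galois_scaffold p v2 b2 Psi1 Psi2 /\
  forall (alpha : L) (i j : nat),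
    val_congr v2 (p ^ 2) b2 alpha -> (i <= p - 1)%N -> (j <= p - 1)%N ->
    v2 (galgebra_act (Psi2 ^+ i * Psi1 ^+ j) alpha) =
      (v2 alpha + (i * b2 + j * p * b1)%:Z%:E)%E.
Proof.
move=> mu eps bound eps_bound cyc_bound Psi1 Psi2.
have p_prime : prime p by case/andP: kappa_char.
have p_gt1 := prime_gt1 p_prime.
have p2_gt0 : (0 < p ^ 2)%N by rewrite expn_gt0 ltnW.
have v0_norm := lval_normalized kappa.
have K0_pchar := laurent_pchar kappa_char.
have L_pchar : p \in [pchar L] by rewrite pchar_lalg.
have [beta1_val b1_ndvd] : lval beta1 = (- b1%:Z)%:E /\ ~~ (p %| b1)%N.
  by case: data => [[_ _ _ []]|[_ _ _ []]].
have b1_gt0 : (0 < b1)%N by rewrite lt0n; apply: contraNneq b1_ndvd => ->.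
have [q [mu_q beta2_q eps_ge bound_lt]] :=
  mu_valuation kappa_char beta1_val eps_bound.
(* With $m=b_1-p^2q$, the additional cyclic assumption reads $m>p^2b_1$. *)
have cyc_lt : cyclic_data p b1 beta1 beta2 x1 x2 sigma1 sigma2 ->
    (p ^ 2)%N%:Z * q - b1%:Z < - (p ^ 2 * b1)%N%:Z.
  move=> [/cyc_bound cyc _ _ _ _].
  have := bound_lt _ _ cyc (val_exp v0_norm p beta1_val).
  by rewrite expnS expn1; clear; lia.
have wp0 : wp p (0 : laurent kappa) = 0.
  by rewrite /wp expr0n gtn_eqF ?subr0// ltnW.
(* In the elementary abelian case $\beta_2$ competes with $\beta_1$ (coefficients 0 and 1, $k=0$),
   so $v_0(\beta_2)\le v_0(\beta_1)$. In the cyclic case $m>p^2b_1$ forces $q<0$. *)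
have q_le0 : q <= 0.
  case: data => [[_ _ [indep b1max _] _ _]|/cyc_lt]; last first.
    by move: (p ^ 2)%N p2_gt0; clear; nia.
  have := b1max (Ordinal (ltnW p_gt1)) (Ordinal p_gt1) 0.
  rewrite /= mulr0n mulr1n wp0 add0r addr0 => b2max.
  have : (lval beta2 <= lval beta1)%E.
    apply: b2max => b2wp.
    have := indep (Ordinal (ltnW p_gt1)) (Ordinal p_gt1).
    by rewrite /= mulr0n mulr1n add0r => /(_ b2wp)[].
  by rewrite beta1_val beta2_q lee_fin; move: p_gt1; clear; nia.
have mu_val : forall n, (n < p)%N -> lval (mu + n%:R) = q%:E.
  apply: (mu_shift_valuation kappa_char beta1_val mu_q beta2_q eps_ge) => //.
  (* At $q=0$ the elementary abelian case uses the maximality of $\beta_2$ in its coset; the cyclic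
     case is void, as $m=b_1$ contradicts $m>p^2b_1$. *)
  move=> q0 n np; case: data => [[_ _ [_ _ b2max] _ _]|/cyc_lt].
    by have := b2max (Ordinal np) 0; rewrite wp0 addr0.
  by rewrite q0; move: (p ^ 2)%N p2_gt0; clear; nia.
have [k qE] : exists k : nat, q = - k%:Z.
  by exists `|q|%N; move: q_le0; clear; lia.
subst q.
(* From $p\,v_0(\varepsilon)>-m$ follows $v_2(\varepsilon)=p^2v_0(\varepsilon)>-pm$. *)
have eps_val :
    ((1 - (p * (b1 + p ^ 2 * k))%N%:Z)%:E <= v2 eps%:A)%E.
  have [->|/(val_fin v0_norm)[n epsn]] := eqVneq eps 0.
    by rewrite scale0r; apply: val_ge0.
  rewrite (val_alg L_ramified epsn) lee_fin.
  have := bound_lt _ _ eps_bound epsn.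
  by rewrite expnS expn1; move: p_gt1; clear; nia.
case: data => [|cyc].
  move=> [_ [wp_x1 wp_x2 _] _ _ [s1x1 s1x2 s2x1 s2x2]].
  (* Here both the error term and $\delta=\sigma_1x_2-x_2$ are 0. *)
  have {}wp_x2 : wp p x2 = 0 + beta2%:A by rewrite wp_x2 add0r.
  apply: (Artin_Schreier_scaffold K0_pchar v0_norm v2_normalized L_ramified
    L_dim L_galois b1_ndvd beta1_val wp_x1 wp_x2 mu_val eps_val) => //.
  - exact: val_ge0.
  - by rewrite -s1x1 addrC subrK.
  - by apply/eqP; rewrite -subr_eq0 s2x1.
  - by rewrite -s2x2 addrC subrK.
  - by rewrite s1x2 rmorph0.
  - by move=> [//|i] _; rewrite s1x2 gbinom0S; apply: val_ge0.
have {cyc_lt} m_lt := cyc_lt cyc.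
case: cyc => [_ [wp_x1 wp_x2 _] _ _ [_ s1x1E s2E s2x2E]].
have s1x1 : sigma1 x1 = x1 + 1 by rewrite -s1x1E addrC subrK.
have s2x2 : sigma2 x2 = x2 + 1 by rewrite -s2x2E addrC subrK.
have x1_val :=
  val_Artin_Schreier v2_normalized L_ramified p_gt1 b1_gt0 beta1_val wp_x1.
have beta1A_val : v2 beta1%:A = (- (p ^ 2 * b1)%N%:Z)%:E.
  by rewrite (val_alg L_ramified beta1_val); congr EFin; clear; lia.
apply: (Artin_Schreier_scaffold K0_pchar v0_norm v2_normalized L_ramified
    L_dim L_galois b1_ndvd beta1_val wp_x1 wp_x2 mu_val eps_val) => //.
(* The bound on [D1] is at least $-p^3b_1$, which exceeds $-pm$. *)
- apply: val_geW (val_ge_D1 v2_normalized p_gt1 beta1A_val x1_val).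
  by move: m_lt p_gt1; rewrite expnS expn1; clear; nia.
(* $\sigma_1^p$ translates $x_1$ by $p=0$. *)
- by rewrite s2E (gal_expg_add1 _ s1x1) pcharf0 ?addr0.
(* $\sigma_2$ is a power of $\sigma_1$; evaluating both orders of the product at $x_2$ shows that
   $\sigma_2$ fixes $\delta$. *)
- have comm : (sigma1 * sigma2 = sigma2 * sigma1)%g.
    by rewrite s2E -expgS -expgSr.
  have : (sigma1 * sigma2)%g x2 = (sigma2 * sigma1)%g x2 by rewrite comm.
  rewrite !galM ?memvf// s2x2 rmorphD rmorph1 /= => s2s1x2.
  by rewrite rmorphB /= s2s1x2 s2x2; ring.
- move=> i /andP[i_gt0 ip].
  have delta_val : ((- ((p - 1) * (p * b1))%N%:Z)%:E <=
      v2 (sigma1 x2 - x2)%R)%E.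
    apply: (val_ge_wp v2_normalized p_gt1); first by rewrite oppr_le0.
    have s1_wp : wp p (sigma1 x2) = sigma1 (wp p x2).
      by rewrite /wp rmorphB rmorphXn.
    rewrite wpB// s1_wp wp_x2 rmorphD /=.
    rewrite rmorph_alg opprD addrACA subrr addr0.
    exact: val_ge_D1_shift.
  have w0 : - ((p - 1) * (p * b1))%N%:Z <= 0 :> int by rewrite oppr_le0.
  (* The valuation of $\binom{\delta}{i}$ is at least $-i(p-1)pb_1$, and $m\ge p^2b_1+1$ gives
     $i(m-(p-1)pb_1)\ge pb_1+1$. *)
  apply: val_geW (val_ge_gbinom L_pchar v2_normalized ip w0 delta_val).
  by move: m_lt p_gt1 i_gt0; rewrite expnS expn1; clear; nia.
Qed.
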